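(* Let $H$ be a separable real Hilbert space with norm $\|\cdot\|$ and inner product $\langle\cdot,\cdot\rangle$. Let $(Y,X)$ be a random pair with values in $H\times\mathbb{R}$, where $X$ has a probability density $p$, and for $x$ in the support of $p$ let $\mu_x$ denote the conditional law of $Y$ given $X=x$. Let $(X_n,Y_n)_{n\ge1}$ be independent copies of $(X,Y)$, let $K:\mathbb{R}\to\mathbb{R}$ be a kernel, and let $(\gamma_n)_{n\ge1}$, $(h_n)_{n\ge1}$ be deterministic sequences of positive numbers. For a fixed $x\in\mathbb{R}$ and a given initial point $Z_1(x)\in H$, define recursively $$Z_{n+1}(x)=Z_n(x)+\gamma_n\,\frac{Y_{n+1}-Z_n(x)}{\|Y_{n+1}-Z_n(x)\|}\,\frac{1}{h_n}K\!\left(\frac{X_{n+1}-x}{h_n}\right),\qquad n\ge1.$$ Let $m(x)$ be the conditional geometric median of $Y$ given $X=x$, i.e. the minimizer over $\alpha\in H$ of $G(\alpha,x)=p(x)\,\mathbb{E}\big[\|Y-\alpha\|-\|Y\|\,\big|\,X=x\big]$, and let $\Phi(x,\alpha)=-p(x)\,\mathbb{E}\big[\frac{Y-\alpha}{\|Y-\alpha\|}\,\big|\,X=x\big]$. Assume: (A1) for every $x$ in the support of $p$ and every $v\in H$ there exists $w\in H$ with $\langle v,w\rangle=0$ and $\mathrm{Var}(\langle w,Y\rangle\mid X=x)>0$; (A2) $p$ is bounded and there are constants $\beta>0$, $C_2>0$ with $|p(x)-p(x')|\le C_2|x-x'|^\beta$ for all $x,x'\in\mathbb{R}$; (A3) there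 is $C_3>0$ such that $\|\Phi(x,\alpha)-\Phi(x',\alpha)\|\le C_3|x-x'|^\beta$ for all $x,x'\in\mathbb{R}$ and all $\alpha\in H$ (with the same $\beta$ as in (A2)); (A5) $K$ is nonnegative, bounded, has compact support and $\int_{\mathbb{R}}K(u)\,du=1$. If moreover $\sum_n\gamma_n=\infty$, $\sum_n\gamma_n^2h_n^{-1}<\infty$ and $\sum_n\gamma_nh_n^\beta<\infty$, then for every $x$ with $p(x)>0$, $$\lim_{n\to\infty}\|Z_n(x)-m(x)\|=0\quad\text{almost surely.}$$
   Context: Under (A1) the minimizer $m(x)$ of $G(\cdot,x)$ exists and is unique whenever $p(x)>0$. The conditional expectations are taken with respect to the conditional law $\mu_x$. *)

(* Defs.v *)
From HB Require Import structures.
From mathcomp Require Import all_boot all_order all_algebra.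
From mathcomp Require Import all_classical all_reals all_analysis measurable_realfun.
Set Implicit Arguments. Unset Strict Implicit. Unset Printing Implicit Defensive.
Import Order.TTheory GRing.Theory Num.Theory numFieldNormedType.Exports.
Local Open Scope classical_set_scope.
Local Open Scope ring_scope.

Section defs.
Context {R : realType}.

(** [ip] is an inner product on the real normed space [H] inducing its norm
    (so a complete such [H] is a real Hilbert space). *)
Definition is_inner_product (H : normedModType R) (ip : H -> H -> R) : Prop :=
  [/\ (forall u v, ip u v = ip v u),
      (forall (a : R) u v w, ip (a *: u + v) w = a * ip u w + ip v w) &
      (forall u, ip u u = `|u| ^+ 2)].

Definition separable_space (T : topologicalType) : Prop :=
  exists D : set T, countable D /\ closure D = setT.

Definition borelType (T : topologicalType) := g_sigma_algebraType (@open T).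

(** the unit vector v / ||v|| (with the convention 0/0 = 0) *)
Definition unitv (H : normedModType R) (v : H) : H := `|v|^-1 *: v.

Variable H : normedModType R.

(** [(X, Y)] has joint law p(x) dx mu_x(dy): X has density p and
    mu_x is (a version of) the conditional law of Y given X = x *)
Definition joint_law d (Omega : measurableType d) (P : probability Omega R)
    (X : Omega -> R) (Y : Omega -> borelType H) (p : R -> R)
    (mu : R -> probability (borelType H) R) : Prop :=
  [/\ measurable_fun setT X, measurable_fun setT Y,
      (forall B : set (borelType H), measurable B ->
         measurable_fun setT (fun x : R => mu x B)) &
      forall (A : set R) (B : set (borelType H)), measurable A -> measurable B ->
        P (X @^-1` A `&` Y @^-1` B) =
        (\int[lebesgue_measure]_(x in A) ((p x)%:E * mu x B))%E].

Definition indep_pairs d (Omega : measurableType d) (P : probability Omega R)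
    (X : nat -> Omega -> R) (Y : nat -> Omega -> borelType H) : Prop :=
  forall (I : seq nat) (A : nat -> set R) (B : nat -> set (borelType H)),
    uniq I -> (forall i, measurable (A i)) -> (forall i, measurable (B i)) ->
    P (\bigcap_(i in [set` I]) (X i @^-1` A i `&` Y i @^-1` B i)) =
    (\prod_(i <- I) P (X i @^-1` A i `&` Y i @^-1` B i))%E.

Definition cond_exp (mu : R -> probability (borelType H) R) (x : R)
    (f : H -> R) : \bar R :=
  (\int[mu x]_y (f y)%:E)%E.

(** Var(f(Y) | X = x) (equal to +oo when f(Y) is not square integrable) *)
Definition cond_var (mu : R -> probability (borelType H) R) (x : R)
    (f : H -> R) : \bar R :=
  (\int[mu x]_y ((f y - fine (cond_exp mu x f)) ^+ 2)%:E)%E.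

Definition Gfun (p : R -> R) (mu : R -> probability (borelType H) R)
    (alpha : H) (x : R) : R :=
  p x * fine (cond_exp mu x (fun y => `|y - alpha| - `|y|)).

(** [phi] = Phi(x, alpha) = - p(x) E[ (Y - alpha)/||Y - alpha|| | X = x ],
    the H-valued conditional expectation being characterized weakly (Pettis):
    <phi, w> = - p(x) E[ <(Y - alpha)/||Y - alpha||, w> | X = x ] for all w. *)
Definition is_Phi (ip : H -> H -> R) (p : R -> R)
    (mu : R -> probability (borelType H) R) (x : R) (alpha phi : H) : Prop :=
  forall w : H, ip phi w = - p x * fine (cond_exp mu x (fun y => ip (unitv (y - alpha)) w)).

(** the recursive estimator, shifted: Zalg n = Z_{n+1}(x),
    gam n = gamma_{n+1}, h n = h_{n+1}, X n = X_{n+1}, Y n = Y_{n+1}. *)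
Fixpoint Zalg (Omega : Type) (K : R -> R) (gam h : nat -> R)
    (X : nat -> Omega -> R) (Y : nat -> Omega -> H) (x : R) (z1 : H)
    (n : nat) (w : Omega) : H :=
  match n with
  | 0 => z1
  | k.+1 =>
      let z := Zalg K gam h X Y x z1 k w in
      z + (gam k * (h k)^-1 * K ((X k.+1 w - x) / h k)) *: unitv (Y k.+1 w - z)
  end.

End defs.

(* Main.v *)
Require Import Defs.
From HB Require Import structures.
From mathcomp Require Import all_boot all_order all_algebra.
From mathcomp Require Import all_classical all_reals all_analysis measurable_realfun.
From mathcomp Require Import ring lra.
Import Order.TTheory GRing.Theory Num.Theory numFieldNormedType.Exports.
Local Open Scope classical_set_scope.
Local Open Scope ring_scope.

(** Put [Q n = ln (1 + |Z n - m|^2)]. Conditioning on the past freezes [Z n] at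
    some [z]; by (A3) and the kernel properties, the mean of the increment of
    [|Z - m|^2] is then at most [- 2 gam <z - m, Phi(x, z)>] plus errors which,
    after division by [1 + |z - m|^2], are bounded by a summable sequence. The
    drift [<z - m, Phi(x, z)>] dominates [G z - G m], hence, [m] being a minimizer,
    the second difference [G z + G m - 2 G ((z + m)/2)]. By (A1) the support of
    the conditional law contains two points that are linearly independent as
    seen from [m]; near one of them the triangle inequality has a defect bounded
    below uniformly on [r <= |z - m| <= A], although spheres of [H] are not
    compact. So [Q] is a nonnegative almost-supermartingale that strictly
    decreases in mean away from [0] and [+oo]. A maximal inequality shows that
    [Q] is bounded almost surely; since the steps have infinite sum it returns
    near [0] at arbitrarily late times; and, by the maximal inequality started
    at such a return, it stays there. *)

(** * Geometry of inner product spaces *)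

(** Conditional expectations are never formed: the supermartingale property is an inequality between
    integrals over events of the past, obtained from Fubini on two independent sub-sigma-algebras. A
    single step may be as long as a multiple of [gam / h], which the summability conditions do not
    force to be small, so paths may jump across an annulus. Only means are under control; this is
    why the maximal inequality works with a potential that is capped at the level to be crossed.
    (A3) speaks of vectors that represent conditional means of unit vectors; such vectors are
    supplied by Riesz representation, where completeness of [H] enters. Separability makes sums and
    scalar multiples Borel measurable and makes the complement of the support a null set. No moment
    of [Y] is assumed: the law of [Y] enters through differences of norms and unit vectors, which
    are bounded. *)

Section inner_product.
Context {R : realType} {H : normedModType R} {ip : H -> H -> R}.
Hypothesis Hip : is_inner_product ip.

Lemma ipC u v : ip u v = ip v u.
Proof. by case: Hip => + _ _; exact. Qed.

Lemma ip_linear a u v w : ip (a *: u + v) w = a * ip u w + ip v w.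
Proof. by case: Hip => _ + _; exact. Qed.

Lemma ipvv u : ip u u = `|u| ^+ 2.
Proof. by case: Hip => _ _; exact. Qed.

Lemma ipDl u v w : ip (u + v) w = ip u w + ip v w.
Proof. by rewrite -[u]scale1r ip_linear scale1r mul1r. Qed.

Lemma ip0l w : ip 0 w = 0.
Proof. by have := ipDl 0 0 w; rewrite addr0; lra. Qed.

Lemma ipZl a u w : ip (a *: u) w = a * ip u w.
Proof. by rewrite -[a *: u]addr0 ip_linear ip0l addr0. Qed.

Lemma ipNl u w : ip (- u) w = - ip u w.
Proof. by rewrite -scaleN1r ipZl mulN1r. Qed.

Lemma ipBl u v w : ip (u - v) w = ip u w - ip v w.
Proof. by rewrite ipDl ipNl. Qed.

Lemma ipDr u v w : ip w (u + v) = ip w u + ip w v.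
Proof. by rewrite ipC ipDl !(ipC _ w). Qed.

Lemma ipZr a u w : ip w (a *: u) = a * ip w u.
Proof. by rewrite ipC ipZl (ipC u). Qed.

Lemma ipNr u w : ip w (- u) = - ip w u.
Proof. by rewrite ipC ipNl (ipC u). Qed.

Lemma ipBr u v w : ip w (u - v) = ip w u - ip w v.
Proof. by rewrite ipDr ipNr. Qed.

Lemma ip0r w : ip w 0 = 0.
Proof. by rewrite ipC ip0l. Qed.

Lemma sqr_normD u v : `|u + v| ^+ 2 = `|u| ^+ 2 + 2 * ip u v + `|v| ^+ 2.
Proof. by rewrite -!ipvv ipDl !ipDr (ipC v u); ring. Qed.

Lemma sqr_normB u v : `|u - v| ^+ 2 = `|u| ^+ 2 - 2 * ip u v + `|v| ^+ 2.
Proof. by rewrite sqr_normD ipNr normrN; ring. Qed.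

Lemma gram_ge0 u v : ip u v ^+ 2 <= `|u| ^+ 2 * `|v| ^+ 2.
Proof.
have [->|v0] := eqVneq v 0; first by rewrite ip0r normr0; lra.
have vp : 0 < `|v| ^+ 2 by rewrite exprn_gt0// normr_gt0.
have := sqr_ge0 `| (`|v| ^+ 2) *: u - ip u v *: v|.
rewrite sqr_normB !normrZ ipZl ipZr.
rewrite !exprMn !real_normK ?num_real//.
set a := `|u| ^+ 2; set b := `|v| ^+ 2 in vp *; set c := ip u v.
suff -> : b ^+ 2 * a - 2 * (b * (c * c)) + c ^+ 2 * b = b * (a * b - c ^+ 2).
  by rewrite pmulr_rge0// subr_ge0.
by ring.
Qed.

Lemma cauchy_schwarz u v : `|ip u v| <= `|u| * `|v|.
Proof.
rewrite -(@ler_pXn2r _ 2)// ?nnegrE ?mulr_ge0//.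
by rewrite real_normK ?num_real// exprMn gram_ge0.
Qed.

Lemma ip_le u v : ip u v <= `|u| * `|v|.
Proof. exact: le_trans (ler_norm _) (cauchy_schwarz _ _). Qed.

Lemma norm_unitv_le1 (v : H) : `|unitv v| <= 1.
Proof.
rewrite /unitv normrZ normfV normr_id.
by have [->|v0] := eqVneq v 0; rewrite ?normr0 ?mulr0// mulVf// normr_eq0.
Qed.

Lemma ip_unitv (v : H) : ip (unitv v) v = `|v|.
Proof.
rewrite /unitv ipZl ipvv.
have [->|v0] := eqVneq v 0; first by rewrite normr0; ring.
by rewrite expr2 mulrA mulVf ?mul1r// normr_eq0.
Qed.

(* [- unitv (y - z)] is a subgradient at [z] of [fun alpha => `|y - alpha|]. *)
Lemma unitv_subgradient (y z m : H) :
  `|y - z| - `|y - m| <= - ip (unitv (y - z)) (z - m).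
Proof.
have -> : z - m = (y - m) - (y - z) by rewrite opprB [RHS]addrC addrA subrK.
rewrite ipBr ip_unitv opprB lerD2l lerN2.
apply: (le_trans (ip_le _ _)).
by rewrite -[leRHS]mul1r ler_wpM2r// norm_unitv_le1.
Qed.

(** The Gram determinant is invariant under shears. With [a = y - m] and [v = z - m] it transfers a
    lower bound for the pair [(a, v)] to the pair [(y - m, y - z)] whose triangle defect is
    estimated. *)
Lemma gramB a v :
  `|a| ^+ 2 * `|a - v| ^+ 2 - ip a (a - v) ^+ 2 = `|a| ^+ 2 * `|v| ^+ 2 - ip a v ^+ 2.
Proof. by rewrite sqr_normB ipBr ipvv; ring. Qed.

(** With s = |a|, t = |b|, w = |a + b| and c = <a, b>, one has (s + t - w)(s + t + w) = 2 (st - c),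
    while the Gram determinant factors as (st - c)(st + c) with st + c <= 2st. Thus the defect
    controls how far [a] and [b] are from being parallel. *)
Lemma triangle_defect (a b : H) :
  `|a| ^+ 2 * `|b| ^+ 2 - ip a b ^+ 2 <=
  (`|a| + `|b| - `|a + b|) * (2 * (`|a| + `|b|) * (`|a| * `|b|)).
Proof.
have cs := ip_le a b; have tri := ler_normD a b.
have := sqr_normD a b.
have := normr_ge0 a; have := normr_ge0 b; have := normr_ge0 (a + b).
move: cs tri.
set s := `|a|; set t := `|b|; set w := `|a + b|; set c := ip a b.
move=> cs tri w0 t0 s0 E.
have E1 : (s + t - w) * (s + t + w) = 2 * (s * t - c) by lra.
have h1 : 2 * (s * t - c) <= (s + t - w) * (2 * (s + t)).
  by rewrite -E1 ler_wpM2l ?subr_ge0//; lra.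
have st0 : 0 <= s * t by exact: mulr_ge0.
have h2 : s ^+ 2 * t ^+ 2 - c ^+ 2 <= (2 * (s * t - c)) * (s * t).
  have -> : s ^+ 2 * t ^+ 2 - c ^+ 2 = (s * t - c) * (s * t + c) by ring.
  have -> : (2 * (s * t - c)) * (s * t) = (s * t - c) * (s * t + s * t) by ring.
  by rewrite ler_wpM2l ?subr_ge0// lerD2l.
apply: (le_trans h2); have := ler_wpM2r st0 h1; lra.
Qed.

(** The Gram determinant divided by |v|^2 is the squared distance from [a] to the line spanned by
    [v]; the witness is the coefficient of the orthogonal projection. *)
Lemma near_line (a v : H) (eta : R) : 0 < eta -> v != 0 ->
  `|a| ^+ 2 * `|v| ^+ 2 - ip a v ^+ 2 < eta ^+ 2 * `|v| ^+ 2 ->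
  exists s : R, `|a - s *: v| < eta.
Proof.
move=> eta0 v0 g; exists (ip a v / `|v| ^+ 2).
have vp : 0 < `|v| ^+ 2 by rewrite exprn_gt0// normr_gt0.
rewrite -(@ltr_pXn2r _ 2)// ?nnegrE ?(ltW eta0)//.
rewrite sqr_normB ipZr normrZ exprMn real_normK ?num_real//.
rewrite -(ltr_pM2r vp); apply: le_lt_trans g.
rewrite le_eqVlt; apply/orP; left; apply/eqP.
by move: vp; set b := `|v| ^+ 2 => vp; field; rewrite gt_eqF.
Qed.

(** One [eta] serves all directions [v]; this replaces compactness of the sphere. If both
    alternatives failed, [a1] and [a2] would both lie close to the line of [v], hence be almost
    proportional, against the nonzero component [w] of [a2] orthogonal to [a1]. *)
Lemma two_lines (a1 a2 : H) : a1 != 0 -> (forall t : R, a2 != t *: a1) ->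
  exists2 eta : R, 0 < eta & forall v : H,
    (forall a, `|a - a1| < eta ->
      eta ^+ 2 * `|v| ^+ 2 <= `|a| ^+ 2 * `|v| ^+ 2 - ip a v ^+ 2) \/
    (forall a, `|a - a2| < eta ->
      eta ^+ 2 * `|v| ^+ 2 <= `|a| ^+ 2 * `|v| ^+ 2 - ip a v ^+ 2).
Proof.
move=> a10 indep; pose w := a2 - (ip a1 a2 / `|a1| ^+ 2) *: a1.
have n1 : 0 < `|a1| by rewrite normr_gt0.
have w0 : 0 < `|w| by rewrite normr_gt0 subr_eq0 indep.
have ip1 : ip a1 w = 0.
  rewrite /w ipBr ipZr ipvv -mulrA mulVf ?mulr1 ?subrr//.
  by rewrite expf_neq0// gt_eqF.
have ip2 : ip a2 w = `|w| ^+ 2.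
  rewrite -ipvv {2}/w ipBl [X in _ - X]ipZl ip1; ring.
(* The bounds ensure [|s| |v| >= |a1| / 2], [|w| - th >= |w| / 2] and [|t| |v| < |a2| + 1]; with the
   last one the two failures give |a1||w|/4 <= (|a2| + 1) th <= |a1||w|/5, a contradiction. *)
pose th := Num.min (Num.min (`|a1| / 2) (`|w| / 2))
                   (Num.min 1 (`|a1| * `|w| / (5 * (`|a2| + 1)))).
have n2 : 0 <= `|a2| by [].
have th0 : 0 < th.
  by rewrite !lt_min ltr01 !divr_gt0// mulr_gt0// ltr_wpDl.
have [tha1 thw th1 thm] : [/\ th <= `|a1| / 2, th <= `|w| / 2, th <= 1 &
    th * (5 * (`|a2| + 1)) <= `|a1| * `|w|].
  split; rewrite ?ge_min ?lexx ?orbT//.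
  by rewrite -ler_pdivlMr ?mulr_gt0 ?ltr_wpDl// !ge_min lexx !orbT.
exists (th / 2); first exact: divr_gt0.
move=> v; have [->|v0] := eqVneq v 0.
  by left => a _; rewrite normr0 ip0r; lra.
(* Half of [th] is spent on the distance from [a1'] to the bad point [a], the other half on the
   distance from [a] to the line. *)
have far a1' : (~ forall a, `|a - a1'| < th / 2 -> (th / 2) ^+ 2 * `|v| ^+ 2 <=
    `|a| ^+ 2 * `|v| ^+ 2 - ip a v ^+ 2) -> exists s : R, `|a1' - s *: v| < th.
  move=> /existsNP[a /not_implyP[aa /negP]]; rewrite -ltNge => /near_line[||s ss]//.
    exact: divr_gt0.
  exists s; rewrite (le_lt_trans (ler_distD a _ _))// distrC [ltRHS]splitr.
  exact: ltrD.
apply: contrapT => /not_orP[/far[s hs] /far[t ht]].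
(* Elimination of [v]: the combination [s a2 - t a1] involves only the small residuals, and pairing
   it with [w] removes [a1]. *)
pose r1 := a1 - s *: v; pose r2 := a2 - t *: v.
have e : ip (s *: a2 - t *: a1) w = ip (s *: r2 - t *: r1) w.
  congr (ip _ w); rewrite /r1 /r2 !scalerBr !scalerA (mulrC s t).
  by rewrite opprB addrA subrK.
move: e; rewrite !ipBl !ipZl ip1 ip2 mulr0 subr0 => e.
have : `|s| * `|v| * `|w| ^+ 2 <= `|s| * `|v| * (th * `|w|) + `|t| * `|v| * (th * `|w|).
  have h1 : `|ip r1 w| <= th * `|w|.
    by apply: (le_trans (cauchy_schwarz _ _)); rewrite ler_wpM2r// ltW.
  have h2 : `|ip r2 w| <= th * `|w|.
    by apply: (le_trans (cauchy_schwarz _ _)); rewrite ler_wpM2r// ltW.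
  have : `|s| * `|w| ^+ 2 <= `|s| * (th * `|w|) + `|t| * (th * `|w|).
    have -> : `|s| * `|w| ^+ 2 = `|s * ip r2 w - t * ip r1 w|.
      by rewrite -e normrM (@ger0_norm _ (`|w| ^+ 2)) ?sqr_ge0.
    apply: (le_trans (ler_normB _ _)); rewrite !normrM.
    by rewrite lerD// ler_wpM2l.
  move=> /(ler_wpM2r (normr_ge0 v)); lra.
have S1 : `|a1| - th < `|s| * `|v|.
  rewrite -normrZ; have := ler_normD r1 (s *: v); rewrite subrK -/r1 in hs *.
  by lra.
have T1 : `|t| * `|v| < `|a2| + th.
  rewrite -normrZ; have := ler_normB a2 r2; rewrite opprB addrC subrK.
  by rewrite -/r2 in ht; lra.
move: S1 T1; set S := `|s| * `|v|; set T := `|t| * `|v| => S1 T1 h.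
have {}h : S * (`|w| - th) <= T * th.
  rewrite -(ler_pM2r w0); move: h; lra.
have : (`|a1| / 2) * (`|w| / 2) <= S * (`|w| - th).
  by apply: ler_pM; lra.
have : T * th <= (`|a2| + 1) * th by rewrite ler_wpM2r//; lra.
have := mulr_gt0 n1 w0; lra.
Qed.

End inner_product.

(** * Riesz representation of bounded linear functionals *)

Section riesz.
Context {R : realType} {H : completeNormedModType R} (ip : H -> H -> R).
Hypothesis Hip : is_inner_product ip.

(* The representing vector is the limit of a minimizing sequence of
   [v |-> |v|^2 - 2 L v], which is Cauchy by the parallelogram identity. *)
Lemma riesz_representation (L : H -> R) (C : R) :
  (forall a u v, L (a *: u + v) = a * L u + L v) ->
  (forall v, `|L v| <= C * `|v|) ->
  exists phi, forall w, ip phi w = L w.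
Proof.
move=> Llin Lbnd.
have LD u v : L (u + v) = L u + L v by rewrite -[u]scale1r Llin mul1r scale1r.
have L0 : L 0 = 0 by have := LD 0 0; rewrite addr0; lra.
have LZ a u : L (a *: u) = a * L u by rewrite -[a *: u]addr0 Llin L0 addr0.
pose J v := `|v| ^+ 2 - 2 * L v.
have Jlb v : - C ^+ 2 <= J v.
  have : L v <= C * `|v| by exact: le_trans (ler_norm _) (Lbnd _).
  have := sqr_ge0 (`|v| - C); rewrite sqrrB /J -mulr_natl; lra.
have hJ : has_inf (range J).
  by split; [exists (J 0), 0|exists (- C ^+ 2) => _ [v _ <-]].
pose j := inf (range J).
have jJ v : j <= J v by apply: ge_inf; [case: hJ|exists v].
have Jmid u v : `|u - v| ^+ 2 = 2 * J u + 2 * J v - 4 * J (2^-1 *: (u + v)).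
  rewrite /J LZ LD normrZ exprMn (@ger0_norm _ (2^-1))// (sqr_normB Hip) (sqr_normD Hip).
  by field.
have ex n : exists v, J v < j + (n.+1%:R^-1) ^+ 2.
  have /(inf_adherent) : 0 < (n.+1%:R^-1 : R) ^+ 2 by rewrite exprn_gt0// invr_gt0.
  by move=> /(_ _ hJ)[_ [v _ <-]] ?; exists v.
have [v vP] := choice ex.
pose e n : R := n.+1%:R^-1.
have e0 n : 0 < e n by rewrite invr_gt0.
have ee m n : (n <= m)%N -> e m <= e n by move=> nm; rewrite lef_pV2 ?posrE// ler_nat.
have vC m n : (n <= m)%N -> `|v n - v m| <= 2 * e n.
  move=> nm; rewrite -(@ler_pXn2r _ 2)// ?nnegrE ?mulr_ge0// ?(ltW (e0 _))//.
  rewrite Jmid; have := jJ (2^-1 *: (v n + v m)); have := vP n; have := vP m.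
  rewrite -/(e n) -/(e m).
  have : e m ^+ 2 <= e n ^+ 2 by rewrite ler_pXn2r ?nnegrE ?(ltW (e0 _))// ee.
  by rewrite exprMn; lra.
have e_small (eps : R) : 0 < eps -> exists N, e N < eps.
  move=> eps0; exists (Num.truncn eps^-1); rewrite /e invf_plt ?posrE//.
  exact: truncnS_gt.
have /cauchy_cvg/cvg_ex[phi vphi] : cauchy (v @ \oo).
  apply: cauchy_exP => eps eps0; have [N eN] := e_small _ (divr_gt0 eps0 (ltr0Sn R 1)).
  exists (v N); exists N => // m /= Nm; rewrite -ball_normE/=.
  by rewrite (le_lt_trans (vC _ _ Nm))// mulrC -ltr_pdivlMr.
have phiv n : `|phi - v n| <= 2 * e n.
  apply: contrapT => /negP; rewrite -ltNge => lt.
  have := @cvgr_dist_lt _ _ _ _ _ _ _ vphi (`|phi - v n| - 2 * e n).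
  rewrite subr_gt0 => /(_ _ lt)[N _ /(_ (maxn n N))] /=.
  rewrite leq_maxr => /(_ isT); have := vC _ _ (leq_maxl n N).
  have := ler_distD (v (maxn n N)) phi (v n); rewrite (distrC (v (maxn n N)) (v n)).
  lra.
exists phi => w; have [->|w0] := eqVneq w 0; first by rewrite (ip0r Hip).
have wp : 0 < `|w| ^+ 2 by rewrite exprn_gt0// normr_gt0.
(* The step [t = - del / |w|^2] minimizes [J] along the line through [v n] in direction [w] and
   lowers it by del^2 / |w|^2. Since [v n] is within [e n ^+ 2] of the infimum, this gain is below
   [e n ^+ 2]. *)
have close n : `|ip (v n) w - L w| <= e n * `|w|.
  rewrite -(@ler_pXn2r _ 2)// ?nnegrE ?mulr_ge0// ?(ltW (e0 _))//.
  rewrite real_normK ?num_real// exprMn.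
  set del := ip _ _ - _; set b := `|w| ^+ 2 in wp *.
  have := jJ (v n + (- del / b) *: w); have := vP n; rewrite -/(e n).
  rewrite /J LD LZ (sqr_normD Hip) (ipZr Hip) normrZ exprMn real_normK ?num_real// -/b.
  set t := - del / b.
  have tb : t * b = - del by rewrite /t; field; rewrite gt_eqF.
  have E : 2 * (t * ip (v n) w) - 2 * (t * L w) + t ^+ 2 * b = - (del ^+ 2) / b.
    rewrite (_ : _ - _ = 2 * t * del); last by rewrite /del; ring.
    by rewrite /t; field; rewrite gt_eqF.
  move=> h1 h2; have : 0 < e n ^+ 2 - del ^+ 2 / b by rewrite mulNr in E; lra.
  by rewrite subr_gt0 ltr_pdivrMr// => /ltW.
apply/eqP; rewrite -subr_eq0 -normr_le0; apply/ler_addgt0Pr => eps eps0.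
rewrite add0r; have w1 : 0 < 3 * `|w| by rewrite mulr_gt0// normr_gt0.
have [N eN] := e_small _ (divr_gt0 eps0 w1).
have -> : ip phi w - L w = ip (phi - v N) w + (ip (v N) w - L w).
  by rewrite (ipBl Hip); ring.
apply: (le_trans (ler_normD _ _)).
have := close N; have := cauchy_schwarz Hip (phi - v N) w.
have := ler_wpM2r (normr_ge0 w) (phiv N).
move: eN; rewrite ltr_pdivlMr//; lra.
Qed.

End riesz.

(** * Borel measurability in separable spaces *)

Section borel_measurability.
Context {R : realType} {d : measure_display} {T : measurableType d}.

Lemma separable_sequence (V : normedModType R) : separable_space V ->
  exists s : nat -> V, forall (v : V) (e : R), 0 < e -> exists n, ball (s n) e v.
Proof.
move=> [D [/countable_injP[f finj] Dcl]].
(* Indices that are not the image of a point of [D] get the default value 0; extra terms do no harm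
   to density. *)
pose s n : V := if pselect (exists2 v, D v & f v = n) is left P then sval (cid2 P) else 0.
exists s => v e e0.
have : closure D v by rewrite Dcl.
move=> /(_ (ball v e) (nbhsx_ballx v e e0))[w [Dw vw]].
exists (f w); rewrite /s; case: pselect => [P|]; last by case; exists w.
case: cid2 => w' /= Dw' /finj; rewrite !inE => -> //; exact: ball_sym.
Qed.

Lemma separable_real : separable_space R.
Proof.
exists (range (@ratr R)); split; first exact: (sub_countable (card_image_le _ _)).
apply/seteqP; split => // x _ B /nbhs_ballP[e /= e0 eB].
have [||y [xy [q _ qy]]] := @dense_rat R (ball x e).
- by exists x; exact: ballxx.
- exact: ball_open.
- by exists y; split; [exists q|exact: eB].
Qed.

Lemma borel_measurableP (V : normedModType R) (f : T -> V) :
  measurable_fun setT (f : T -> borelType V) <->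
  forall O : set V, open O -> measurable (f @^-1` O).
Proof.
split=> [mf O oO|mO].
  by rewrite -[X in measurable X]setTI; apply: mf => //; exact: sub_sigma_algebra.
apply: (@measurability _ _ _ (borelType V) _ _ (@open V)) => // _ [ O oO <-].
by rewrite setTI; exact: mO.
Qed.

Lemma real_measurableP (f : T -> R) : measurable_fun setT f <->
  forall O : set R, open O -> measurable (f @^-1` O).
Proof.
split=> [mf O oO|mO].
  by rewrite -[X in measurable X]setTI; apply: mf => //; exact: open_measurable.
apply: (measurability _ (RGenOpens.measurableE R)) => _ [_ [a [b ->] <-]].
by rewrite setTI; apply: mO; exact: interval_open.
Qed.

(** In separable spaces an open set of the product is a countable union of rectangles of balls with
    centers in dense sequences and radii 1/(k+1). Hence jointly continuous operations preserve Borel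
    measurability. *)
Lemma measurable_preimage_open2 (V W : normedModType R) (f : T -> V) (g : T -> W)
    (O : set (V * W)) : separable_space V -> separable_space W ->
  (forall O', open O' -> measurable (f @^-1` O')) ->
  (forall O', open O' -> measurable (g @^-1` O')) ->
  open O -> measurable [set t | O (f t, g t)].
Proof.
move=> /separable_sequence[s sP] /separable_sequence[s' s'P] mf mg oO.
pose good (i j k : nat) := (ball (s i) k.+1%:R^-1 `*` ball (s' j) k.+1%:R^-1) `<=` O.
have -> : [set t | O (f t, g t)] = \bigcup_i \bigcup_j \bigcup_(k in good i j)
    (f @^-1` (ball (s i) k.+1%:R^-1) `&` g @^-1` (ball (s' j) k.+1%:R^-1)).
  apply/seteqP; split => t /=; last first.
    by move=> [i _ [j _ [k gd [fk gk]]]]; apply: gd; split.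
  move=> Ovw; pose v := f t; pose w := g t.
  have /nbhs_ballP[e /= e0 eO] : nbhs (v, w) O by exact: open_nbhs_nbhs.
  have [k ke] : exists k : nat, k.+1%:R^-1 < e / 2.
    exists (Num.truncn (e / 2)^-1); rewrite invf_plt ?posrE ?divr_gt0//.
    exact: truncnS_gt.
  have [i vi] := sP v k.+1%:R^-1 ltac:(by rewrite invr_gt0).
  have [j wj] := s'P w k.+1%:R^-1 ltac:(by rewrite invr_gt0).
  exists i => //; exists j => //; exists k; last by split.
  move=> -[v' w'] [/= vv' ww'].
  apply: eO; split => /=; rewrite [e]splitr.
    apply: (@le_ball _ _ _ (k.+1%:R^-1 + k.+1%:R^-1)).
      by apply: ltW; exact: ltrD.
    by apply: ball_triangle vv'; exact: ball_sym.
  apply: (@le_ball _ _ _ (k.+1%:R^-1 + k.+1%:R^-1)).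
    by apply: ltW; exact: ltrD.
  by apply: ball_triangle ww'; exact: ball_sym.
do 2 apply: bigcupT_measurable => ?; apply: bigcup_measurable => k _.
by apply: measurableI; [apply: mf|apply: mg]; exact: ball_open.
Qed.

Context {H : normedModType R} (Hsep : separable_space H).
Implicit Types f g : T -> H.

Lemma measurable_addv f g : measurable_fun setT (f : T -> borelType H) ->
  measurable_fun setT (g : T -> borelType H) ->
  measurable_fun setT ((fun t => f t + g t) : T -> borelType H).
Proof.
move=> /borel_measurableP mf /borel_measurableP mg; apply/borel_measurableP => O oO.
apply: (@measurable_preimage_open2 _ _ f g ((fun z : H * H => z.1 + z.2) @^-1` O)) => //.
by apply: open_comp oO => z _; exact: add_continuous.
Qed.

Lemma measurable_scalev (a : T -> R) f : measurable_fun setT a ->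
  measurable_fun setT (f : T -> borelType H) ->
  measurable_fun setT ((fun t => a t *: f t) : T -> borelType H).
Proof.
move=> /real_measurableP ma /borel_measurableP mf; apply/borel_measurableP => O oO.
apply: (@measurable_preimage_open2 R H a f ((fun z : R * H => z.1 *: z.2) @^-1` O)) => //.
  exact: separable_real.
by apply: open_comp oO => z _; exact: scale_continuous.
Qed.

Lemma measurable_oppv f : measurable_fun setT (f : T -> borelType H) ->
  measurable_fun setT ((fun t => - f t) : T -> borelType H).
Proof.
move=> /borel_measurableP mf; apply/borel_measurableP => O oO.
have : open ((fun v : H => - v) @^-1` O) by apply: open_comp oO => z _; exact: oppr_continuous.
exact: mf.
Qed.

Lemma measurable_subv f g : measurable_fun setT (f : T -> borelType H) ->
  measurable_fun setT (g : T -> borelType H) ->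
  measurable_fun setT ((fun t => f t - g t) : T -> borelType H).
Proof. by move=> mf mg; apply: measurable_addv => //; exact: measurable_oppv. Qed.

Lemma measurable_normv f : measurable_fun setT (f : T -> borelType H) ->
  measurable_fun setT (fun t => `|f t|).
Proof.
move=> /borel_measurableP mf; apply/real_measurableP => O oO.
have : open ((fun v : H => `|v|) @^-1` O) by apply: open_comp oO => z _; exact: norm_continuous.
exact: mf.
Qed.

Lemma measurable_unitv f : measurable_fun setT (f : T -> borelType H) ->
  measurable_fun setT ((fun t => unitv (f t)) : T -> borelType H).
Proof.
move=> mf; rewrite (_ : (fun t => _) = (fun t => (`|f t| `^ (-1)) *: f t)).
  apply: measurable_scalev => //.
  exact: (measurableT_comp (measurable_powR (-1)) (measurable_normv _ mf)).
by apply/funext => t; rewrite /unitv powR_inv1.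
Qed.

Lemma measurable_ip (ip : H -> H -> R) f g : is_inner_product ip ->
  measurable_fun setT (f : T -> borelType H) ->
  measurable_fun setT (g : T -> borelType H) ->
  measurable_fun setT (fun t => ip (f t) (g t)).
Proof.
move=> Hip mf mg; rewrite (_ : (fun t => _) =
    (fun t => 2^-1 * (`|f t + g t| ^+ 2 - `|f t| ^+ 2 - `|g t| ^+ 2))).
  apply: measurable_funM => //; apply: measurable_funB; first apply: measurable_funB.
  - by apply: measurable_funX; apply: measurable_normv; exact: measurable_addv.
  - by apply: measurable_funX; exact: measurable_normv.
  - by apply: measurable_funX; exact: measurable_normv.
by apply/funext => t; rewrite (sqr_normD Hip); field.
Qed.

End borel_measurability.

(** * Integration against a disintegrated law *)

Section measure_induction.
Context {R : realType} {d : measure_display} {T : measurableType d}.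
Local Open Scope ereal_scope.

Import HBNNSimple.

Lemma ge0_measurable_fun_ind (Pr : (T -> \bar R) -> Prop) :
  (forall A, measurable A -> Pr (fun x => (\1_A x)%:E)) ->
  (forall (a : R) f, (0 <= a)%R -> (forall x, 0 <= f x) ->
    measurable_fun setT f -> Pr f -> Pr (fun x => a%:E * f x)) ->
  (forall f g, (forall x, 0 <= f x) -> (forall x, 0 <= g x) ->
    measurable_fun setT f -> measurable_fun setT g ->
    Pr f -> Pr g -> Pr (fun x => f x + g x)) ->
  (forall f_ : nat -> T -> \bar R, (forall n x, 0 <= f_ n x) ->
    (forall n, measurable_fun setT (f_ n)) ->
    (forall x, nondecreasing_seq (f_ ^~ x)) -> (forall n, Pr (f_ n)) ->
    Pr (fun x => limn (f_ ^~ x))) ->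
  forall f, (forall x, 0 <= f x) -> measurable_fun setT f -> Pr f.
Proof.
move=> Pind Pscale Padd Plim f f0 mf.
have Pnnsfun (g : {nnsfun T >-> R}) : Pr (fun x => (g x)%:E).
  (* Additivity of [Pr] is available only for nonnegative measurable functions, so both properties
     are carried through the induction on the values of the simple function. *)
  pose Q (u : T -> \bar R) := [/\ forall x, 0 <= u x, measurable_fun setT u & Pr u].
  suff [] : Q (fun x => (g x)%:E) by [].
  rewrite (_ : (fun x => (g x)%:E) = (fun x => \sum_(y <- finmap.enum_fset (fset_set (range g)))
      (y * \1_(g @^-1` [set y]) x)%:E)); last first.
    apply/funext => x; rewrite sumEFin; congr EFin.
    by rewrite [LHS]fimfunE fsbig_finite.
  have ge0 y : y \in finmap.enum_fset (fset_set (range g)) -> (0 <= y)%R.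
    by move=> ys; have : y \in range g; [rewrite -in_fset_set|move=> /set_mem[x _ <-]].
  elim: (finmap.enum_fset _) ge0 => [|y s ih] ge0.
    rewrite (_ : (fun x => _) = (fun x => (\1_(set0 : set T) x)%:E)).
      split; [by move=> x; rewrite lee_fin| |exact: Pind].
      by apply/measurable_EFinP; exact: measurable_indic.
    by apply/funext => x; rewrite big_nil indic0.
  have [|ih0 ihm ihP] := ih; first by move=> z zs; apply: ge0; rewrite inE zs orbT.
  have y0 : (0 <= y)%R by apply: ge0; rewrite inE eqxx.
  have mi : measurable_fun setT (fun x : T => (\1_(g @^-1` [set y]) x)%:E : \bar R).
    by apply/measurable_EFinP; exact: measurable_indic.
  have my : measurable_fun setT (fun x : T => y%:E * (\1_(g @^-1` [set y]) x)%:E).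
    exact: measurable_funeM.
  rewrite (_ : (fun x => _) = (fun x => y%:E * (\1_(g @^-1` [set y]) x)%:E +
      \sum_(z <- s) (z * \1_(g @^-1` [set z]) x)%:E)); last first.
    by apply/funext => x; rewrite big_cons EFinM.
  have h0 x : 0 <= y%:E * (\1_(g @^-1` [set y]) x)%:E by rewrite mule_ge0// lee_fin.
  split; [by move=> x; rewrite adde_ge0|exact: emeasurable_funD|].
  apply: Padd => //; apply: Pscale => //; exact: Pind.
pose f_ := nnsfun_approx measurableT mf.
rewrite (_ : f = (fun x => limn (fun n => (f_ n x)%:E))); last first.
  by apply/funext => x; apply/esym/cvg_lim => //; exact: cvg_nnsfun_approx.
apply: (Plim (fun n x => (f_ n x)%:E)) => //.
- by move=> n x; rewrite lee_fin.
- by move=> n; exact/measurable_EFinP.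
- by move=> x a b ab; rewrite lee_fin; exact/lefP/nd_nnsfun_approx.
Qed.

Lemma bounded_integrable (mu : {finite_measure set T -> \bar R}) (f : T -> R) (C : R) :
  measurable_fun setT f -> (forall x, `|f x| <= C)%R ->
  mu.-integrable setT (EFin \o f).
Proof.
move=> mf fC; apply: measurable_bounded_integrable => //.
  by rewrite fin_num_fun_lty//; exact: fin_num_measure.
by exists C; split; [exact: num_real|move=> M CM x _; exact: le_trans (fC x) (ltW CM)].
Qed.

End measure_induction.

(** * Mass of a rescaled kernel *)

Section affine_substitution.
Context {R : realType}.
Local Notation leb := (@lebesgue_measure R).

(** The image of Lebesgue measure under the affine map, multiplied by [h^-1], gives half-open
    intervals their length, hence is Lebesgue measure again. *)
Lemma integral_rescale (K : R -> R) (x h : R) : 0 < h ->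
  measurable_fun setT K -> (forall u, 0 <= K u) ->
  (\int[leb]_x' (h^-1 * K ((x' - x) / h))%:E = \int[leb]_u (K u)%:E)%E.
Proof.
move=> h0 mK K0.
pose f (x' : measurableTypeR R) : measurableTypeR R := ((x' : R) - x) / h.
have mf : measurable_fun setT f.
  by apply: (@measurable_funM _ (measurableTypeR R) R) => //; exact: measurable_funB.
have hi0 : 0 <= h^-1 by rewrite invr_ge0 ltW.
under eq_integral do rewrite EFinM.
have mKf : measurable_fun setT (fun x' : R => (K ((x' - x) / h))%:E).
  by apply/measurable_EFinP; exact: (measurableT_comp mK mf).
rewrite ge0_integralZl//; last by move=> *; rewrite lee_fin.
have -> : (\int[leb]_x' (K ((x' - x) / h))%:E =
    \int[pushforward leb f]_u (K u)%:E)%E.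
  rewrite (ge0_integral_pushforward mf leb (D := setT))//.
    exact/measurable_EFinP.
  by move=> u _; rewrite lee_fin.
pose nu : {measure set (measurableTypeR R) -> \bar R} := pushforward leb f.
have mKE : measurable_fun setT (fun u : measurableTypeR R => (K u)%:E).
  exact/measurable_EFinP.
have KE0 (u : measurableTypeR R) : setT u -> (0 <= (K u)%:E)%E by rewrite lee_fin.
rewrite -[LHS](@ge0_integral_mscale _ _ R (nu mf) setT measurableT (NngNum hi0)
  (fun u => (K u)%:E) mKE KE0).
apply: eq_measure_integral => A mA _; apply/esym.
apply: lebesgue_measure_unique => //= _ [[a b] /= ab <-].
rewrite /mscale/= /pushforward.
have -> : f @^-1` `]a, b]%classic = `]x + a * h, x + b * h]%classic.
  apply/seteqP; split => u /=; rewrite /f !in_itv/= ltr_pdivlMr// ler_pdivrMr//.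
    by rewrite ltrBrDl lerBlDl.
  by rewrite ltrBrDl lerBlDl.
rewrite !lebesgue_measure_itv/= !lte_fin ltrD2l ltr_pM2r//.
case: ifPn => _; last by rewrite mule0.
by rewrite -!EFinB -EFinM; congr EFin; field; rewrite gt_eqF.
Qed.
End affine_substitution.

(** * From measurable rectangles to integrals against the joint law *)

Section disintegration.
Context {R : realType} {H : normedModType R} {d : measure_display}
  {Omega : measurableType d} {P : probability Omega R}.
Context {X : Omega -> R} {Y : Omega -> borelType H} {p : R -> R}
  {mu : R -> probability (borelType H) R}.
Hypotheses (Hlaw : joint_law P X Y p mu) (p0 : forall x, 0 <= p x)
  (mp : measurable_fun setT p).
Local Notation leb := (@lebesgue_measure R).
Local Open Scope ereal_scope.

Let mX : measurable_fun setT X. Proof. by case: Hlaw. Qed.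
Let mY : measurable_fun setT Y. Proof. by case: Hlaw. Qed.
Let mmu B : measurable B -> measurable_fun setT (fun x => mu x B).
Proof. by case: Hlaw => _ _ + _; exact. Qed.

Lemma measurable_fun_integral_law (f : borelType H -> \bar R) :
  (forall y, 0 <= f y) -> measurable_fun setT f ->
  measurable_fun setT (fun x => \int[mu x]_y f y).
Proof.
by move=> f0 mf; apply: (measurable_fun_integral_kernel (l := mu)).
Qed.

Let limM (c : \bar R) (u : (\bar R)^nat) : c \is a fin_num ->
  nondecreasing_seq u -> c * limn u = limn (fun n => c * u n).
Proof.
by move=> cfin ndu; rewrite limeMl//; exact: ereal_nondecreasing_is_cvgn.
Qed.

(** For fixed [B] both sides are additive and monotone-continuous in [k], and for an indicator [k]
    the identity is the rectangle formula of [joint_law]. *)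
Let joint_law_indic (B : set (borelType H)) (k : R -> \bar R) : measurable B ->
  (forall x, 0 <= k x) -> measurable_fun setT k ->
  \int[P]_w (k (X w) * (\1_B (Y w))%:E) = \int[leb]_x (k x * ((p x)%:E * mu x B)).
Proof.
move=> mB; move: k.
have mw : measurable_fun setT (fun x => (p x)%:E * mu x B).
  by apply: emeasurable_funM; [exact/measurable_EFinP|exact: mmu].
have w0 x : 0 <= (p x)%:E * mu x B by rewrite mule_ge0// lee_fin.
have wfin x : (p x)%:E * mu x B \is a fin_num.
  by rewrite fin_numM// fin_num_measure.
have mB' : measurable_fun setT (fun w : Omega => (\1_B (Y w))%:E : \bar R).
  by apply/measurable_EFinP; apply: (measurableT_comp _ mY); exact: measurable_indic.
have B0 w : 0 <= (\1_B (Y w))%:E :> \bar R by rewrite lee_fin.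
apply: ge0_measurable_fun_ind.
- move=> A mA; transitivity (P (X @^-1` A `&` Y @^-1` B)).
    have mAB : measurable (X @^-1` A `&` Y @^-1` B).
      apply: measurableI.
        by rewrite -[X in measurable X]setTI; exact: mX.
      by rewrite -[X in measurable X]setTI; exact: mY.
    rewrite -[in RHS](setIT (X @^-1` A `&` _)) -integral_indic//.
    apply: eq_integral => w _; rewrite -EFinM; congr EFin.
    by rewrite [RHS]indicE in_setI -mulnb natrM.
  case: Hlaw => _ _ _ ->//; rewrite integral_mkcond.
  by apply: eq_integral => x _; rewrite muleC epatch_indic.
- move=> a f a0 f0 mf ih.
  under eq_integral do rewrite -muleA.
  under [RHS]eq_integral do rewrite -muleA.
  rewrite !ge0_integralZl ?ih//.
  + by apply: emeasurable_funM.
  + by move=> x _; rewrite mule_ge0.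
  + by apply: emeasurable_funM => //; exact: (measurableT_comp mf mX).
  + by move=> x _; rewrite mule_ge0.
- move=> f g f0 g0 mf mg ihf ihg.
  under eq_integral do rewrite ge0_muleDl//.
  under [RHS]eq_integral do rewrite ge0_muleDl//.
  rewrite !ge0_integralD ?ihf ?ihg//.
  + by move=> x _; rewrite mule_ge0.
  + by apply: emeasurable_funM.
  + by move=> x _; rewrite mule_ge0.
  + by apply: emeasurable_funM.
  + by move=> x _; rewrite mule_ge0.
  + by apply: emeasurable_funM => //; exact: (measurableT_comp mf mX).
  + by move=> x _; rewrite mule_ge0.
  + by apply: emeasurable_funM => //; exact: (measurableT_comp mg mX).
- move=> f_ f0 mf ndf ih.
  under eq_integral do rewrite muleC limM//.
  under [RHS]eq_integral do rewrite muleC limM//.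
  rewrite !monotone_convergence//.
  + congr (limn _); apply/funext => n.
    transitivity (\int[P]_w (f_ n (X w) * (\1_B (Y w))%:E)).
      by apply: eq_integral => w _; rewrite muleC.
    by rewrite ih; apply: eq_integral => x _; rewrite muleC.
  + by move=> n; apply: emeasurable_funM; [exact: mw|exact: mf].
  + by move=> n x _; rewrite mule_ge0.
  + by move=> x _ a b ab; rewrite lee_wpmul2l//; exact: ndf.
  + by move=> n; apply: emeasurable_funM => //; exact: (measurableT_comp (mf n) mX).
  + by move=> n x _; rewrite mule_ge0.
  + by move=> x _ a b ab; rewrite lee_wpmul2l//; exact: ndf.
Qed.

(** A second induction, now on [f] with [k] fixed; its base case is [joint_law_indic]. Product
    integrands are all that the kernel estimator requires. *)
Lemma ge0_integral_joint_law (k : R -> R) (f : borelType H -> \bar R) :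
  (forall x, (0 <= k x)%R) -> measurable_fun setT k ->
  (forall y, 0 <= f y) -> measurable_fun setT f ->
  \int[P]_w ((k (X w))%:E * f (Y w)) =
  \int[leb]_x ((k x * p x)%:E * \int[mu x]_y f y).
Proof.
move=> k0 mk; move: f.
have mkp : measurable_fun setT (fun x => (k x * p x)%:E).
  by apply/measurable_EFinP; exact: measurable_funM.
have kp0 x : 0 <= (k x * p x)%:E by rewrite lee_fin mulr_ge0.
have mkX : measurable_fun setT (fun w => (k (X w))%:E).
  by apply/measurable_EFinP; exact: (measurableT_comp mk mX).
have kX0 w : 0 <= (k (X w))%:E by rewrite lee_fin.
have I0 f x : (forall y, 0 <= f y) -> 0 <= \int[mu x]_y f y.
  by move=> f0; apply: integral_ge0.
apply: ge0_measurable_fun_ind.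
- move=> B mB; rewrite (@joint_law_indic B (fun x => (k x)%:E))//; last exact/measurable_EFinP.
  apply: eq_integral => x _; rewrite integral_indic// setIT EFinM.
  by rewrite muleA.
- move=> a f a0 f0 mf ih.
  under eq_integral do rewrite muleCA.
  under [RHS]eq_integral do rewrite ge0_integralZl// muleCA.
  rewrite !ge0_integralZl ?ih//.
  + apply: emeasurable_funM; first exact: mkp.
    exact: measurable_fun_integral_law.
  + by move=> x _; rewrite mule_ge0// I0.
  + by apply: emeasurable_funM => //; exact: (measurableT_comp mf mY).
  + by move=> x _; rewrite mule_ge0.
- move=> f g f0 g0 mf mg ihf ihg.
  under eq_integral do rewrite ge0_muleDr//.
  under [RHS]eq_integral do rewrite ge0_integralD// ge0_muleDr ?I0//.
  rewrite !ge0_integralD ?ihf ?ihg//.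
  + by move=> x _; rewrite mule_ge0// I0.
  + by apply: emeasurable_funM; [exact: mkp|exact: measurable_fun_integral_law].
  + by move=> x _; rewrite mule_ge0// I0.
  + by apply: emeasurable_funM; [exact: mkp|exact: measurable_fun_integral_law].
  + by move=> x _; rewrite mule_ge0.
  + by apply: emeasurable_funM => //; exact: (measurableT_comp mf mY).
  + by move=> x _; rewrite mule_ge0.
  + by apply: emeasurable_funM => //; exact: (measurableT_comp mg mY).
- move=> f_ f0 mf ndf ih.
  have ndI x : nondecreasing_seq (fun n => \int[mu x]_y f_ n y).
    by move=> a b ab; apply: ge0_le_integral => // y _; exact: ndf.
  have IE x : \int[mu x]_y limn (f_ ^~ y) = limn (fun n => \int[mu x]_y f_ n y).
    by rewrite monotone_convergence// => y _; exact: ndf.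
  under eq_integral do rewrite limM//.
  under [RHS]eq_integral do rewrite IE limM//.
  rewrite !monotone_convergence//.
  + by congr (limn _); apply/funext => n; exact: ih.
  + move=> n; apply: emeasurable_funM; first exact: mkp.
    exact: measurable_fun_integral_law.
  + by move=> n x _; rewrite mule_ge0// I0.
  + by move=> x _ a b ab; rewrite lee_wpmul2l//; exact: ndI.
  + by move=> n; apply: emeasurable_funM => //; exact: (measurableT_comp (mf n) mY).
  + by move=> n x _; rewrite mule_ge0.
  + by move=> x _ a b ab; rewrite lee_wpmul2l//; exact: ndf.
Qed.

End disintegration.

(** * Independence and Fubini *)

Section independence.
Context {R : realType} {d : measure_display} {Omega : measurableType d}
  {P : probability Omega R}.
Local Open Scope ereal_scope.

(** Both sides are finite measures in [A]: the restriction of [P] to [B], and [P] scaled by [P B].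
    They agree on a generating family closed under intersection. *)
Let indep_sigma_left (C : set (set Omega)) (B : set Omega) :
  C `<=` measurable -> setI_closed C -> C setT -> measurable B ->
  (forall A, C A -> P (A `&` B) = P A * P B) ->
  forall A, <<s C >> A -> P (A `&` B) = P A * P B.
Proof.
move=> Cm CI CT mB PC.
have b0 : (0 <= fine (P B))%R by rewrite fine_ge0.
have Bfin : (fine (P B))%:E = P B by rewrite fineK// fin_num_measure.
pose m1 : {measure set Omega -> \bar R} := mrestr P mB.
pose m2 : {measure set Omega -> \bar R} := mscale (NngNum b0) P.
have m2E A : m2 A = P A * P B by rewrite /m2/= /mscale/= Bfin muleC.
move=> A sA; rewrite -m2E -[LHS]/(m1 A).
apply: (@g_sigma_algebra_measure_unique _ _ _ C Cm (fun=> setT)) => //.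
- by rewrite bigcup_const.
- by move=> D CD; rewrite m2E; exact: PC.
- move=> _; rewrite -[X in X < _]/(P _) setTI.
  by rewrite ltey_eq fin_num_measure.
Qed.

Variables (C1 C2 : set (set Omega)).
Hypotheses (C1m : C1 `<=` measurable) (C2m : C2 `<=` measurable).
Hypotheses (C1I : setI_closed C1) (C2I : setI_closed C2).
Hypotheses (C1T : C1 setT) (C2T : C2 setT).
Hypothesis indep : forall A B, C1 A -> C2 B -> P (A `&` B) = P A * P B.

Let s1m : <<s C1 >> `<=` measurable.
Proof. exact: (smallest_sub (@sigma_algebra_measurable _ Omega)). Qed.

Let s2m : <<s C2 >> `<=` measurable.
Proof. exact: (smallest_sub (@sigma_algebra_measurable _ Omega)). Qed.

Lemma indep_sigma A B : <<s C1 >> A -> <<s C2 >> B -> P (A `&` B) = P A * P B.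
Proof.
move=> sA sB; rewrite setIC muleC.
apply: (indep_sigma_left C2) => //; first exact: s1m.
move=> {sB} {}B CB; rewrite setIC muleC.
apply: (indep_sigma_left C1) => //; first exact: C2m.
by move=> {sA} {}A CA; exact: indep.
Qed.

Local Notation T1 := (g_sigma_algebraType C1).
Local Notation T2 := (g_sigma_algebraType C2).

Let mid1 : measurable_fun setT (id : Omega -> T1).
Proof. by move=> _ A mA; rewrite setTI; exact: s1m. Qed.

Let mid2 : measurable_fun setT (id : Omega -> T2).
Proof. by move=> _ A mA; rewrite setTI; exact: s2m. Qed.

(** The source carries the full sigma-algebra, while the two target coordinates carry only the
    sub-sigma-algebras generated by [C1] and [C2]. *)
Let diag (w : Omega) : (T1 * T2)%type := (w, w).

Let mdiag : measurable_fun setT diag.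
Proof. exact/measurable_fun_pairP. Qed.

Let id1 : {mfun Omega >-> T1} :=
  HB.pack (id : Omega -> T1) (isMeasurableFun.Build _ _ _ _ _ mid1).
Let id2 : {mfun Omega >-> T2} :=
  HB.pack (id : Omega -> T2) (isMeasurableFun.Build _ _ _ _ _ mid2).
Let P1 : probability T1 R := distribution P id1.
Let P2 : probability T2 R := distribution P id2.

Section fubini.
Variable F : T1 * T2 -> \bar R.
Hypotheses (F0 : forall z, 0 <= F z) (mF : measurable_fun setT F).

Let mF1 : measurable_fun setT (fubini_F P2 F).
Proof. exact: measurable_fun_fubini_tonelli_F. Qed.

Let fubini_FE w : fubini_F P2 F w = \int[P]_w' F (w, w').
Proof.
rewrite /fubini_F /= (ge0_integral_pushforward mid2 P)//.
by apply: (measurableT_comp mF); exact: (pair1_measurable (w : T1)).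
Qed.

Lemma measurable_fubini_indep :
  measurable_fun setT (fun w : Omega => \int[P]_w' F (w, w')).
Proof.
have -> : (fun w : Omega => \int[P]_w' F (w, w')) = fubini_F P2 F \o (id : Omega -> T1).
  by apply/funext => w; rewrite -fubini_FE.
exact: measurableT_comp mF1 mid1.
Qed.

(** Independence says exactly that the image of [P] under the diagonal map is the product of its
    restrictions to the two sub-sigma-algebras; Tonelli does the rest. Keeping [Omega] as both
    coordinate spaces makes it unnecessary to describe the law of the whole history. *)
Lemma ge0_fubini_indep :
  \int[P]_w F (w, w) = \int[P]_w \int[P]_w' F (w, w').
Proof.
pose Q : {measure set (T1 * T2) -> \bar R} := pushforward P diag.
transitivity (\int[Q mdiag]_z F z).
  by rewrite ge0_integral_pushforward.
transitivity (\int[P1 \x P2]_z F z).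
  apply: eq_measure_integral => A mA _; apply/esym.
  apply: product_measure_unique => // B C mB mC.
  exact: indep_sigma.
rewrite fubini_tonelli1// (ge0_integral_pushforward mid1 P)//; last first.
  by move=> w _; apply: integral_ge0.
by apply: eq_integral => w _; exact: fubini_FE.
Qed.

End fubini.

End independence.

(** * Kernel-weighted means of bounded functions *)

Section joint_law_expectation.
Context {R : realType}.
Local Notation leb := (@lebesgue_measure R).

Lemma holder_measurable (p : R -> R) (C beta : R) : 0 < C -> 0 < beta ->
  (forall x x', `|p x - p x'| <= C * `|x - x'| `^ beta) -> measurable_fun setT p.
Proof.
move=> C0 b0 hp; apply: continuous_measurable_fun => x.
apply/cvgrPdist_le => e e0.
have eC0 : 0 < e / C by exact: divr_gt0.
near=> t; apply: (le_trans (hp _ _)).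
rewrite mulrC -ler_pdivlMr//.
have -> : e / C = ((e / C) `^ beta^-1) `^ beta.
  by rewrite -powRrM mulVf ?gt_eqF// powRr1 ?ltW.
apply: ge0_ler_powR; rewrite ?nnegrE ?powR_ge0 ?(ltW b0)//.
near: t; apply: cvgr_dist_le; first exact: cvg_id.
exact: powR_gt0.
Unshelve. all: by end_near. Qed.

Lemma Rintegral_probability_cst {d : measure_display} {T : measurableType d}
  (m : probability T R) (c : R) : \int[m]_x c = c.
Proof.
rewrite Rintegral_cst// -[RHS]mulr1; congr (_ * _).
by rewrite -[RHS]/(fine 1%:E); congr fine; exact: probability_setT.
Qed.

Context {H : normedModType R} {d : measure_display}
  {Omega : measurableType d} {P : probability Omega R}.
Context {X : Omega -> R} {Y : Omega -> borelType H} {p : R -> R}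
  {mu : R -> probability (borelType H) R}.
Hypotheses (Hlaw : joint_law P X Y p mu) (p0 : forall x, 0 <= p x)
  (mp : measurable_fun setT p).

Let mX : measurable_fun setT X. Proof. by case: Hlaw. Qed.
Let mY : measurable_fun setT Y. Proof. by case: Hlaw. Qed.

Lemma measurable_Rintegral_law (f : borelType H -> R) (C : R) :
  measurable_fun setT f -> (forall y, `|f y| <= C) ->
  measurable_fun setT (fun x => \int[mu x]_y f y).
Proof.
move=> mf fC.
have F0 y : 0 <= f y + C by have := fC y; rewrite ler_norml; lra.
have -> : (fun x => \int[mu x]_y f y) = (fun x => fine (\int[mu x]_y (f y + C)%:E)%E - C).
  apply/funext => x; rewrite -[X in _ = X - _]/(\int[mu x]_y (f y + C)).
  rewrite RintegralD//; last 2 first.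
  - exact: (bounded_integrable _ _ C).
  - exact: (bounded_integrable _ (cst C) `|C|).
  rewrite Rintegral_probability_cst; lra.
apply: measurable_funB => //.
apply: measurableT_comp => //.
apply: (measurable_fun_integral_law Hlaw) => //.
by apply/measurable_EFinP; exact: measurable_funD.
Qed.

Context {k : R -> R} {Ck : R}.
Hypotheses (mk : measurable_fun setT k) (k0 : forall x, 0 <= k x)
  (kC : forall x, k x <= Ck).

Let mkX : measurable_fun setT (fun w => k (X w)).
Proof. exact: (measurableT_comp mk mX). Qed.

(** With the constant function 1 in the joint law identity, the integral of [k p] is the mean of
    [k (X w)], which is at most [Ck]. *)
Lemma integrable_kernel_density : leb.-integrable setT (fun x => (k x * p x)%:E).
Proof.
apply/integrableP; split; first by apply/measurable_EFinP; exact: measurable_funM.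
have := @ge0_integral_joint_law _ _ _ _ _ _ _ _ _ Hlaw p0 mp k (cst 1%E) k0 mk.
move=> /(_ (fun=> lee01) (measurable_cst _)) E.
have -> : (\int[leb]_x `|(k x * p x)%:E| = \int[P]_w (k (X w))%:E)%E.
  transitivity (\int[leb]_x ((k x * p x)%:E * \int[mu x]_y cst 1 y))%E.
    apply: eq_integral => x _.
    rewrite integral_cst// [X in (_ * (_ * X))%E]probability_setT !mule1.
    by rewrite gee0_abs// lee_fin mulr_ge0.
  by rewrite -E; apply: eq_integral => w _; rewrite mule1.
apply: (@le_lt_trans _ _ (\int[P]_w Ck%:E)%E).
  apply: ge0_le_integral => //; [|exact/measurable_EFinP|].
    by move=> *; rewrite lee_fin.
  by move=> *; rewrite lee_fin.
by rewrite integral_cst// [X in (_ * X)%E]probability_setT mule1 ltry.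
Qed.

Lemma integrable_kernel_density_mul (g : R -> R) (C : R) :
  measurable_fun setT g -> (forall x, `|g x| <= C) ->
  leb.-integrable setT (fun x => (k x * (p x * g x))%:E).
Proof.
move=> mg gC.
have -> : (fun x => (k x * (p x * g x))%:E) = (fun x => (k x * p x)%:E * (EFin \o g) x)%E.
  by apply/funext => x; rewrite -EFinM mulrA.
apply: integrableMl => //; [exact: integrable_kernel_density|].
by exists C; split; [exact: num_real|move=> M CM x _; exact: le_trans (gC x) (ltW CM)].
Qed.

Let Rintegral_le (f : borelType H -> R) (C : R) x :
  measurable_fun setT f -> (forall y, `|f y| <= C) -> `|\int[mu x]_y f y| <= C.
Proof.
move=> mf fC; apply: (le_trans (le_normr_Rintegral _ _)) => //.
  exact: (bounded_integrable _ _ C).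
have -> : C = \int[mu x]_y cst C y.
  by rewrite Rintegral_probability_cst.
apply: le_Rintegral => //.
- by apply: (bounded_integrable _ _ C) => [|y]; [exact: measurableT_comp|rewrite normr_id].
- exact: (bounded_integrable _ (cst C) `|C|).
Qed.

(** The nonnegative identity is applied to [f + C] and to the constant [C], and the two are
    subtracted; the integrability lemmas above make all four integrals finite. *)
Lemma expectation_joint_law (f : borelType H -> R) (C : R) :
  measurable_fun setT f -> (forall y, `|f y| <= C) ->
  \int[P]_w (k (X w) * f (Y w)) = \int[leb]_x (k x * (p x * \int[mu x]_y f y)).
Proof.
move=> mf fC.
have C0 : 0 <= C by apply: le_trans (fC point).
have F0 y : 0 <= f y + C by have := fC y; rewrite ler_norml; lra.
have mF : measurable_fun setT (fun y => f y + C) by exact: measurable_funD.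
have bF (g : borelType H -> R) (B : R) : measurable_fun setT g -> (forall y, 0 <= g y) ->
    (forall y, `|g y| <= B) ->
    \int[P]_w (k (X w) * g (Y w)) = \int[leb]_x (k x * (p x * \int[mu x]_y g y)).
  move=> mg g0 gB; congr fine.
  have := @ge0_integral_joint_law _ _ _ _ _ _ _ _ _ Hlaw p0 mp k (EFin \o g) k0 mk.
  move=> /(_ _ _)/=; under eq_integral do rewrite -EFinM.
  move=> ->; [|by move=> y; rewrite lee_fin|exact/measurable_EFinP].
  apply: eq_integral => x _; rewrite [in RHS]mulrA [in RHS]EFinM; congr (_ * _)%E.
  rewrite fineK// integrable_fin_num//.
  exact: (bounded_integrable _ _ B).
have FB y : `|f y + C| <= C + C.
  by apply: (le_trans (ler_normD _ _)); rewrite (ger0_norm C0) lerD2r.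
have := bF _ _ mF F0 FB.
have := bF (cst C) C (measurable_cst _) (fun=> C0) (fun=> ltac:(by rewrite /= ger0_norm)).
have Ck0 : 0 <= Ck by exact: le_trans (k0 0) (kC 0).
have iP : P.-integrable setT (fun w => (k (X w) * f (Y w))%:E).
  apply: (bounded_integrable _ _ (Ck * C)).
    by apply: measurable_funM => //; exact: (measurableT_comp mf mY).
  by move=> w; rewrite normrM ler_pM// ger0_norm.
have iPC : P.-integrable setT (fun w => (k (X w) * C)%:E).
  apply: (bounded_integrable _ (fun w => k (X w) * C) (Ck * C)).
    exact: measurable_funM.
  by move=> w; rewrite normrM ler_pM// ger0_norm.
have E1 : \int[P]_w (k (X w) * (f (Y w) + C)) =
    \int[P]_w (k (X w) * f (Y w)) + \int[P]_w (k (X w) * C).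
  by rewrite -RintegralD//; apply: eq_Rintegral => w _; rewrite mulrDr.
have muC x : \int[mu x]_y C = C.
  exact: Rintegral_probability_cst.
have E2 : \int[leb]_x (k x * (p x * \int[mu x]_y (f y + C))) =
    \int[leb]_x (k x * (p x * \int[mu x]_y f y)) +
    \int[leb]_x (k x * (p x * \int[mu x]_y C)).
  rewrite -RintegralD//.
  - apply: eq_Rintegral => x _; rewrite -!mulrDr RintegralD//.
      exact: (bounded_integrable _ _ C).
    by apply: (bounded_integrable _ (cst C) C) => // y; rewrite /= ger0_norm.
  - apply: (@integrable_kernel_density_mul _ C); first exact: (measurable_Rintegral_law _ C).
    by move=> x; exact: Rintegral_le.
  - apply: (@integrable_kernel_density_mul _ C).
      by have -> : (fun x : R => \int[mu x]_y C) = cst C by exact/funext.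
    by move=> x; rewrite muC ger0_norm.
rewrite E1 E2 /= => ->; exact: addIr.
Qed.

Hypotheses (intk : (\int[leb]_x (k x)%:E = 1)%E).

Lemma integrable_kernel : leb.-integrable setT (fun x => (k x)%:E).
Proof.
apply/integrableP; split; first exact/measurable_EFinP.
under eq_integral do rewrite gee0_abs ?lee_fin//.
by rewrite intk ltry.
Qed.

(** As [k] has integral 1, the right side is the integral of [k x' * (l + B)], so a pointwise
    comparison where [k] is nonzero is enough. In the main use [l] is the value at the estimation
    point and [B] the variation over the kernel window. *)
Lemma kernel_expectation_le (f : borelType H -> R) (C B l : R) :
  measurable_fun setT f -> (forall y, `|f y| <= C) ->
  (forall x', k x' != 0 -> p x' * \int[mu x']_y f y <= l + B) ->
  \int[P]_w (k (X w) * f (Y w)) <= l + B.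
Proof.
move=> mf fC bnd; rewrite (@expectation_joint_law f C)//.
have -> : l + B = \int[leb]_x (k x * (l + B)).
  rewrite RintegralZr//; last exact: integrable_kernel.
  by rewrite /Rintegral intk mul1r.
apply: le_Rintegral => //.
- apply: (@integrable_kernel_density_mul _ C); first exact: (measurable_Rintegral_law _ C).
  by move=> x; exact: Rintegral_le.
- have -> : EFin \o (fun x => k x * (l + B)) = (fun x => (k x)%:E * (l + B)%:E)%E.
    by apply/funext => x; rewrite /= EFinM.
  by apply: integrableZr => //; exact: integrable_kernel.
- move=> x _; have [->|kx] := eqVneq (k x) 0; first by rewrite !mul0r.
  by rewrite ler_wpM2l// bnd.
Qed.

End joint_law_expectation.

(** * The drift at the geometric median *)

Section median.
Context {R : realType} {H : normedModType R} {ip : H -> H -> R}.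
Hypotheses (Hip : is_inner_product ip) (Hsep : separable_space H).
Variable nu : probability (borelType H) R.

Let mid : measurable_fun setT (id : borelType H -> borelType H).
Proof. exact: measurable_id. Qed.

Let mcst (c : H) : measurable_fun setT ((fun=> c) : borelType H -> borelType H).
Proof. exact: measurable_cst. Qed.

Lemma measurable_ball_borel (c : H) (e : R) : measurable (ball c e : set (borelType H)).
Proof. by apply: sub_sigma_algebra; exact: ball_open. Qed.

Lemma measurable_dist (c : H) :
  measurable_fun setT ((fun y => `|y - c|) : borelType H -> R).
Proof. by apply: measurable_normv => //; exact: measurable_subv. Qed.

(** The balls of a countable basis that have measure zero form a null set [N], and every point
    outside [N] is in the support. If these points all lay on a line through [m] with direction [v],
    a functional <w, .> with [w] orthogonal to [v] would be almost surely constant, against the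
    positive variance. *)
Lemma support_not_on_line (m : H) :
  (forall v : H, exists w : H, ip v w = 0 /\
    (0 < \int[nu]_y ((ip w y - fine (\int[nu]_y (ip w y)%:E)) ^+ 2)%:E)%E) ->
  exists a1 a2 : H, [/\ a1 != 0, forall t : R, a2 != t *: a1,
    (forall e, 0 < e -> (0 < nu (ball (m + a1)%R e))%E) &
    (forall e, 0 < e -> (0 < nu (ball (m + a2)%R e))%E)].
Proof.
move=> hvar; have [s sP] := separable_sequence _ Hsep.
pose B i k : set (borelType H) := ball (s i) k.+1%:R^-1.
pose F i k := if nu (B i k) == 0%E then B i k else set0.
pose N := \bigcup_i \bigcup_k F i k.
have mF i k : measurable (F i k).
  by rewrite /F; case: ifPn => // _; exact: measurable_ball_borel.
have negN : nu.-negligible N.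
  apply: negligible_bigcup => i; apply: negligible_bigcup => k.
  exists (F i k); split => //.
  by rewrite /F; case: ifPn => [/eqP|_] //; rewrite measure0.
have posN y : ~ N y -> forall e, 0 < e -> (0 < nu (ball (y : H) e))%E.
  move=> Ny e e0; rewrite lt_neqAle measure_ge0 andbT eq_sym; apply/negP => /eqP nu0.
  have [k ke] : exists k : nat, k.+1%:R^-1 < e / 2.
    exists (Num.truncn (e / 2)^-1); rewrite invf_plt ?posrE ?divr_gt0//.
    exact: truncnS_gt.
  have [i yi] := sP y k.+1%:R^-1 ltac:(by rewrite invr_gt0).
  apply: Ny; exists i => //; exists k => //; rewrite /F ifT//.
  rewrite eq_le measure_ge0 andbT -nu0.
  apply: le_measure; [by apply: mem_set; exact: measurable_ball_borel..|].
  move=> u iu; rewrite [e]splitr.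
  apply: (@le_ball _ _ _ (k.+1%:R^-1 + k.+1%:R^-1)).
    by apply: ltW; exact: ltrD.
  by apply: ball_triangle iu; exact: ball_sym.
have notline v : exists2 y, ~ N y & forall t : R, y - m != t *: v.
  apply: contrapT => noy.
  have onl y : ~ N y -> exists t : R, y - m = t *: v.
    move=> Ny; apply: contrapT => not; apply: noy; exists y => // t.
    by apply/eqP => e; apply: not; exists t.
  have [w [vw0]] := hvar v.
  have mw : measurable_fun setT ((fun y => ip w y) : borelType H -> R).
    exact: measurable_ip.
  have cst y : ~ N y -> ip w y = ip w m.
    move=> /onl[t e]; rewrite -[y](subrK m) e (ipDr Hip) (ipZr Hip) (ipC Hip w).
    by rewrite vw0 mulr0 add0r.
  have -> : (\int[nu]_y (ip w y)%:E = (ip w m)%:E)%E.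
    transitivity (\int[nu]_y (ip w m)%:E)%E.
      apply: ae_eq_integral => //; first exact/measurable_EFinP.
      by apply: negligibleS negN => y /=; apply: contra_notP => /cst -> _.
    by rewrite integral_cst// [X in (_ * X)%E]probability_setT mule1.
  rewrite /=; have -> : (\int[nu]_y ((ip w y - ip w m) ^+ 2)%:E = 0)%E.
    transitivity (\int[nu]_y 0%:E)%E; last by rewrite integral0.
    apply: ae_eq_integral => //.
      by apply/measurable_EFinP; apply: measurable_funX; exact: measurable_funB.
    apply: negligibleS negN => y /=; apply: contra_notP => /cst -> _.
    by rewrite subrr expr0n.
  by rewrite ltxx.
(* The direction 0 yields a support point different from [m]; the direction of that point then
   yields one off the line joining it to [m]. *)
have [y1 Ny1 y1m] := notline 0.
have [y2 Ny2 y2m] := notline (y1 - m).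
exists (y1 - m), (y2 - m); split => //.
- by have := y1m 0; rewrite scaler0.
- by move=> e e0; rewrite addrC subrK; exact: posN.
- by move=> e e0; rewrite addrC subrK; exact: posN.
Qed.

Variable m : H.
Hypothesis mmin : forall alpha : H,
  \int[nu]_y (`|y - m| - `|y|) <= \int[nu]_y (`|y - alpha| - `|y|).

(** The integrand is bounded by |a - b|, so it is integrable whatever the tails of [nu]. *)
Let int_distB (a b : H) : nu.-integrable setT (fun y => (`|y - a| - `|y - b|)%:E).
Proof.
apply: (bounded_integrable nu (fun y : H => `|y - a| - `|y - b|) `|a - b|).
  by apply: measurable_funB; exact: measurable_dist.
move=> y; apply: (le_trans (ler_dist_dist _ _)).
by rewrite opprB addrC addrA subrK distrC.
Qed.

Let median_le (alpha : H) : 0 <= \int[nu]_y (`|y - alpha| - `|y - m|).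
Proof.
have E : \int[nu]_y (`|y - alpha| - `|y - m|) =
    \int[nu]_y (`|y - alpha| - `|y|) - \int[nu]_y (`|y - m| - `|y|).
  have i a : nu.-integrable setT (EFin \o (fun y => `|y - a| - `|y|)).
    have := int_distB a 0; congr integrable.
    by apply/funext => y; rewrite /= subr0.
  rewrite -RintegralB//; apply: eq_Rintegral => y _; lra.
by rewrite E subr_ge0.
Qed.

Let ip_unitv_bound z y v : `|ip (unitv (y - z)) v| <= `|v|.
Proof.
apply: (le_trans (cauchy_schwarz Hip _ _)).
by rewrite -[leRHS]mul1r ler_wpM2r// norm_unitv_le1.
Qed.

Lemma measurable_ip_unitv z v :
  measurable_fun setT ((fun y => ip (unitv (y - z)) v) : borelType H -> R).
Proof.
apply: measurable_ip => //; apply: measurable_unitv => //.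
exact: measurable_subv.
Qed.

Let drift_ge z : \int[nu]_y (`|y - z| - `|y - m|) <=
  - \int[nu]_y ip (unitv (y - z)) (z - m).
Proof.
have iu : nu.-integrable setT (EFin \o (fun y => ip (unitv (y - z)) (z - m))).
  apply: (bounded_integrable _ _ `|z - m|) => //.
  exact: measurable_ip_unitv.
rewrite -mulN1r -RintegralZl//; apply: le_Rintegral => //.
- exact: int_distB.
- by move: (integrableN iu); congr integrable; apply/funext => y; rewrite /= mulN1r.
- by move=> y _; rewrite mulN1r; exact: unitv_subgradient.
Qed.

Lemma median_drift_ge0 z : 0 <= - \int[nu]_y ip (unitv (y - z)) (z - m).
Proof. exact: le_trans (median_le z) (drift_ge z). Qed.

Variables a1 a2 : H.
Hypotheses (a10 : a1 != 0) (a12 : forall t : R, a2 != t *: a1)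
  (a1s : forall e, 0 < e -> (0 < nu (ball (m + a1)%R e))%E)
  (a2s : forall e, 0 < e -> (0 < nu (ball (m + a2)%R e))%E).

(* Minimality of [m] at the midpoint of [m] and [z] replaces [G z - G m] by the
   defect of the triangle inequality, which is bounded below on one of two
   balls of positive measure. *)
Lemma median_drift_gt0 (r A : R) : 0 < r -> exists2 c, 0 < c &
  forall z, r <= `|z - m| <= A -> c <= - \int[nu]_y ip (unitv (y - z)) (z - m).
Proof.
move=> r0; have [eta eta0 etaP] := two_lines Hip _ _ a10 a12.
(* On both balls |y - m| <= [M] and |y - z| <= [M + b], so [B] bounds the factor in
   [triangle_defect]; [c0] is the lower bound of the Gram determinant divided by [B]. *)
pose M := `|a1| + `|a2| + eta.
have M0 : 0 < M by rewrite /M ltr_wpDl// addr_ge0.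
pose b := `|A| + 1.
have b0 : 0 < b by have := normr_ge0 A; rewrite /b; lra.
pose B := 2 * (M + (M + b)) * (M * (M + b)).
have B0 : 0 < B.
  have Mb : 0 < M + b by lra.
  by rewrite /B !mulr_gt0//; lra.
pose c0 := eta ^+ 2 * r ^+ 2 / B.
have c00 : 0 < c0 by rewrite divr_gt0// mulr_gt0// exprn_gt0.
pose q i : R := fine (nu (ball (m + i) eta)).
have q1 : 0 < q a1.
  by rewrite fine_gt0// a1s//= ltey_eq fin_num_measure//; exact: measurable_ball_borel.
have q2 : 0 < q a2.
  by rewrite fine_gt0// a2s//= ltey_eq fin_num_measure//; exact: measurable_ball_borel.
exists (c0 * Num.min (q a1) (q a2)); first by rewrite mulr_gt0// lt_min q1.
move=> z /andP[rz zA]; apply: le_trans (drift_ge z).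
pose mid' := 2^-1 *: (z + m).
have key : \int[nu]_y (`|y - z| - `|y - m| - 2 * (`|y - mid'| - `|y - m|)) <=
    \int[nu]_y (`|y - z| - `|y - m|).
  have i2 : nu.-integrable setT (EFin \o (fun y : H => 2 * (`|y - mid'| - `|y - m|))).
    have /(integrableZl measurableT 2) := int_distB mid' m.
    by congr integrable; apply/funext => y; rewrite /= EFinM.
  rewrite (RintegralB measurableT (int_distB z m) i2).
  by rewrite (RintegralZl _ measurableT (int_distB mid' m)) lerBlDr lerDl mulr_ge0.
apply: le_trans key.
(* Since (y - m) + (y - z) is twice [y - mid'], the second difference of the distance function is a
   triangle defect. *)
have defect y : `|y - z| - `|y - m| - 2 * (`|y - mid'| - `|y - m|) =
    `|y - m| + `|y - z| - `|(y - m) + (y - z)|.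
  have -> : (y - m) + (y - z) = 2 *: (y - mid').
    rewrite scalerBr scalerA divff// scale1r scaler_nat mulr2n.
    by rewrite opprD addrACA [in RHS](addrC (- z)).
  rewrite normrZ (@ger0_norm _ 2)//; lra.
have defect0 y : 0 <= `|y - m| + `|y - z| - `|(y - m) + (y - z)|.
  by rewrite subr_ge0 ler_normD.
have onball i : (i = a1 \/ i = a2) -> (forall a, `|a - i| < eta ->
      eta ^+ 2 * `|z - m| ^+ 2 <= `|a| ^+ 2 * `|z - m| ^+ 2 - ip a (z - m) ^+ 2) ->
    c0 * q i <= \int[nu]_y (`|y - z| - `|y - m| - 2 * (`|y - mid'| - `|y - m|)).
  move=> ia hi.
  have mball := measurable_ball_borel (m + i) eta.
  have -> : c0 * q i = \int[nu]_y (c0 * \1_(ball (m + i) eta : set (borelType H)) y).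
    rewrite RintegralZl//; last exact: integrable_indic.
    by congr (_ * _); rewrite /Rintegral integral_indic// setIT.
  apply: le_Rintegral => //.
  - apply: (bounded_integrable _ _ c0).
      by apply: measurable_funM => //; exact: measurable_indic.
    move=> y; rewrite ger0_norm; last by apply: mulr_ge0 => //; exact: ltW.
    by rewrite -[leRHS]mulr1 ler_wpM2l ?(ltW c00)// indicE lern1 leq_b1.
  - have := integrableB measurableT (int_distB z m)
      (integrableZl measurableT 2 (int_distB mid' m)).
    by congr integrable; apply/funext => y; rewrite /= EFinB EFinM.
  move=> y _; rewrite defect indicE.
  case: (boolP (y \in _)) => [/set_mem yb|_]; last by rewrite mulr0.
  rewrite mulr1.
  have yb' : `|(y - m) - i| < eta.
    by move: yb; rewrite -ball_normE/= distrC opprD addrA.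
  have := hi _ yb'; rewrite -(gramB Hip).
  have -> : y - m - (z - m) = y - z by rewrite opprB addrA subrK.
  have := triangle_defect Hip (y - m) (y - z).
  set D := `|y - m| + _ - _ => h1 h2.
  have D0 : 0 <= D by exact: defect0.
  have na : `|y - m| <= M.
    have -> : y - m = (y - m - i) + i by rewrite subrK.
    apply: (le_trans (ler_normD _ _)); rewrite /M addrC lerD ?(ltW yb')//.
    by case: ia => ->; rewrite ?lerDl ?lerDr.
  have nb : `|y - z| <= M + b.
    have -> : y - z = (y - m) + (m - z) by rewrite addrA subrK.
    apply: (le_trans (ler_normD _ _)); rewrite lerD// distrC /b.
    by apply: (le_trans zA); apply: (le_trans (ler_norm A)); rewrite lerDl.
  have h3 : eta ^+ 2 * r ^+ 2 <= D * B.
    have h4 : eta ^+ 2 * r ^+ 2 <= eta ^+ 2 * `|z - m| ^+ 2.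
      by rewrite ler_wpM2l ?sqr_ge0// ler_pXn2r ?nnegrE ?(ltW r0).
    apply: (le_trans h4); apply: (le_trans h2); apply: (le_trans h1).
    rewrite ler_wpM2l// /B; apply: ler_pM; rewrite ?mulr_ge0 ?addr_ge0//.
      by rewrite ler_pM2l// lerD.
    exact: ler_pM.
  by rewrite /c0 ler_pdivrMr.
have minle i : (i = a1 \/ i = a2) -> c0 * Num.min (q a1) (q a2) <= c0 * q i.
  by case=> ->; rewrite ler_pM2l// ge_min lexx ?orbT.
(* Which of the two balls is effective depends on the direction of [z - m]; the minimum of their
   measures makes the bound uniform. *)
by case: (etaP (z - m)) => hi; (apply: (le_trans (minle _ _) (onball _ _ hi)));
  [left|left|right|right].
Qed.

End median.

(** * The mean increment of one step *)

Section one_step.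
Context {R : realType} {H : completeNormedModType R} {ip : H -> H -> R}.
Hypotheses (Hip : is_inner_product ip) (Hsep : separable_space H).
Context {p : R -> R} {mu : R -> probability (borelType H) R}.
Hypothesis p0 : forall x, 0 <= p x.

Let int_ip_unitv x z v : (mu x).-integrable setT (EFin \o (fun y : H => ip (unitv (y - z)) v)).
Proof.
apply: (bounded_integrable (mu x) _ `|v|); first exact: measurable_ip_unitv.
move=> y; apply: (le_trans (cauchy_schwarz Hip _ _)).
by rewrite -[leRHS]mul1r ler_wpM2r// norm_unitv_le1.
Qed.

(** The weak definition of Phi is a linear functional of norm at most [p x], because it averages
    unit vectors. Its representing vectors are what (A3) can be applied to. *)
Lemma exists_Phi x z : exists phi, is_Phi ip p mu x z phi.
Proof.
apply: (@riesz_representation R H ip Hip _ (p x)).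
- move=> a u v; rewrite -![fine _]/(\int[mu x]_y _).
  have -> : \int[mu x]_y ip (unitv (y - z)) (a *: u + v) =
      a * \int[mu x]_y ip (unitv (y - z)) u + \int[mu x]_y ip (unitv (y - z)) v.
    rewrite -(RintegralZl _ measurableT (int_ip_unitv x z u)).
    have i1 : (mu x).-integrable setT (EFin \o (fun y : H => a * ip (unitv (y - z)) u)).
      by have := integrableZl measurableT a (int_ip_unitv x z u).
    rewrite -(RintegralD measurableT i1 (int_ip_unitv x z v)).
    by apply: eq_Rintegral => y _; rewrite (ipDr Hip) (ipZr Hip).
  ring.
- move=> v; rewrite -[fine _]/(\int[mu x]_y _) normrM normrN (ger0_norm (p0 x)).
  rewrite ler_wpM2l//.
  apply: (le_trans (le_normr_Rintegral measurableT (int_ip_unitv x z v))).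
  rewrite -[leRHS](Rintegral_probability_cst (mu x)).
  have i2 : (mu x).-integrable setT (EFin \o (fun=> `|v|)).
    by apply: (bounded_integrable (mu x) (cst `|v|) `|v|) => // y; rewrite normr_id.
  apply: (le_Rintegral measurableT (integrable_norm (int_ip_unitv x z v)) i2).
  move=> y _; apply: (le_trans (cauchy_schwarz Hip _ _)).
  by rewrite -[leRHS]mul1r ler_wpM2r// norm_unitv_le1.
Qed.

Variables (beta C3 : R).
Hypothesis A3 : forall (x x' : R) (alpha phi phi' : H),
  is_Phi ip p mu x alpha phi -> is_Phi ip p mu x' alpha phi' ->
  `|phi - phi'| <= C3 * `|x - x'| `^ beta.

Lemma conditional_drift_holder x x' z v :
  p x' * \int[mu x']_y ip (unitv (y - z)) v <=
  p x * (\int[mu x]_y ip (unitv (y - z)) v) + C3 * `|x - x'| `^ beta * `|v|.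
Proof.
have [phi Hphi] := exists_Phi x z; have [phi' Hphi'] := exists_Phi x' z.
have E : p x' * \int[mu x']_y ip (unitv (y - z)) v =
    p x * (\int[mu x]_y ip (unitv (y - z)) v) + ip (phi - phi') v.
  rewrite (ipBl Hip) Hphi Hphi' -![fine _]/(\int[_]_y _); ring.
rewrite E lerD2l; apply: (le_trans (ip_le Hip _ _)).
by rewrite ler_wpM2r//; exact: A3 Hphi Hphi'.
Qed.

(** Concavity of the logarithm: 1 + V' is (1 + V)(1 + t) with t = (V' - V)/(1 + V), and 1 + t <= exp
    t. *)
Lemma lnD1_tangent (V V' : R) : 0 <= V -> 0 <= V' ->
  ln (1 + V') <= ln (1 + V) + (V' - V) / (1 + V).
Proof.
move=> V0 V'0; have W0 : 0 < 1 + V by lra.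
have W'0 : 0 < 1 + V' by lra.
have -> : 1 + V' = (1 + V) * (1 + (V' - V) / (1 + V)) by field; rewrite gt_eqF.
have q : 0 < 1 + (V' - V) / (1 + V).
  have -> : 1 + (V' - V) / (1 + V) = (1 + V') / (1 + V) by field; rewrite gt_eqF.
  exact: divr_gt0.
rewrite lnM ?posrE// lerD2l.
by rewrite -ler_expR lnK ?posrE// expR_ge1Dx.
Qed.

Context {d : measure_display} {Omega : measurableType d} {P : probability Omega R}
  {X : Omega -> R} {Y : Omega -> borelType H}.
Hypotheses (Hlaw : joint_law P X Y p mu) (mp : measurable_fun setT p).
Variables (K : R -> R) (MK Mp rho : R).
Hypotheses (pM : forall x, p x <= Mp) (mK : measurable_fun setT K)
  (K0 : forall u, 0 <= K u) (KM : forall u, K u <= MK)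
  (rho0 : 0 <= rho) (Krho : forall u, K u != 0 -> `|u| <= rho)
  (K1 : (\int[lebesgue_measure]_u (K u)%:E = 1)%E) (beta0 : 0 <= beta) (C30 : 0 <= C3).

Let mX : measurable_fun setT X. Proof. by case: Hlaw. Qed.
Let mY : measurable_fun setT Y. Proof. by case: Hlaw. Qed.

(** The first summand is the bias of averaging Phi over a window of radius [rho * h] instead of
    evaluating it at [x]. The second bounds gam^2 times the second moment of the rescaled kernel,
    which is at most [MK / h] times its mean, itself at most [Mp]. *)
Definition step_error (gam h : R) :=
  C3 * rho `^ beta * (gam * h `^ beta) + MK * Mp * (gam ^+ 2 / h).

(* [ln (1 + |z - m|^2)] absorbs both error terms, which grow with [|z - m|],
   into a constant. *)
Lemma one_step_drift (x gam h : R) (z m : H) : 0 < gam -> 0 < h ->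
  \int[P]_w ln (1 + `|z + (gam * h^-1 * K ((X w - x) / h)) *: unitv ((Y w : H) - z) - m| ^+ 2)
  <= ln (1 + `|z - m| ^+ 2) + step_error gam h -
     2 * gam * (p x * - \int[mu x]_y ip (unitv (y - z)) (z - m)) / (1 + `|z - m| ^+ 2).
Proof.
move=> gam0 h0.
have hn : h != 0 by rewrite gt_eqF.
pose k x' := h^-1 * K ((x' - x) / h).
pose f (y : borelType H) := ip (unitv ((y : H) - z)) (z - m).
pose D := `|z - m|; pose V := D ^+ 2.
have D0 : 0 <= D by exact: normr_ge0.
have V0 : 0 <= V by exact: sqr_ge0.
have k0 x' : 0 <= k x' by rewrite mulr_ge0// invr_ge0 ltW.
have kM x' : k x' <= MK / h by rewrite /k mulrC ler_wpM2r// invr_ge0 ltW.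
have MK0 : 0 <= MK by exact: le_trans (K0 0) (KM 0).
have Mp0 : 0 <= Mp by exact: le_trans (p0 0) (pM 0).
have mk : measurable_fun setT k.
  apply: measurable_funM => //; apply: (measurableT_comp mK).
  by apply: measurable_funM => //; exact: measurable_funB.
have mkX : measurable_fun setT (fun w => k (X w)) by exact: (measurableT_comp mk mX).
have mf : measurable_fun setT f by exact: measurable_ip_unitv.
have mfY : measurable_fun setT (fun w => f (Y w)) by exact: (measurableT_comp mf mY).
have fD y : `|f y| <= D.
  apply: (le_trans (cauchy_schwarz Hip _ _)).
  by rewrite -[leRHS]mul1r ler_wpM2r// norm_unitv_le1.
have k1 : (\int[lebesgue_measure]_x (k x)%:E = 1)%E by rewrite integral_rescale.
have Ekf : \int[P]_w (k (X w) * f (Y w)) <=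
    p x * (\int[mu x]_y f y) + C3 * (rho * h) `^ beta * D.
  apply: (kernel_expectation_le Hlaw p0 mp mk k0 kM k1 f D) => // x' kx'.
  apply: (le_trans (conditional_drift_holder x x' z (z - m))).
  rewrite lerD2l ler_wpM2r// ler_wpM2l//.
  apply: ge0_ler_powR; rewrite ?nnegrE ?mulr_ge0 ?(ltW h0)//.
  have : K ((x' - x) / h) != 0 by apply: contra_neq kx' => E; rewrite /k E mulr0.
  by move=> /Krho; rewrite normrM normfV (gtr0_norm h0) ler_pdivrMr// distrC.
(* The same estimate with the constant function 1, [l = 0] and the supremum of the density as
   [B]. *)
have Ek : \int[P]_w k (X w) <= Mp.
  have := kernel_expectation_le Hlaw p0 mp mk k0 kM k1 (cst 1) 1 Mp 0.
  under eq_Rintegral do rewrite mulr1.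
  rewrite add0r; apply => // [y|x' _]; first by rewrite normr1.
  by rewrite Rintegral_probability_cst mulr1.
have iP (g : Omega -> R) C : measurable_fun setT g -> (forall w, `|g w| <= C) ->
    P.-integrable setT (EFin \o g) by move=> mg gC; exact: (bounded_integrable P g C).
have ikf : P.-integrable setT (EFin \o (fun w => k (X w) * f (Y w))).
  apply: (iP _ (MK / h * D)); first exact: measurable_funM.
  by move=> w; rewrite normrM ler_pM// ger0_norm.
have ik : P.-integrable setT (EFin \o (fun w => k (X w))).
  by apply: (iP _ (MK / h)) => // w; rewrite ger0_norm.
pose V' w := `|z + (gam * k (X w)) *: unitv ((Y w : H) - z) - m| ^+ 2.
(* [c2] comes from k^2 <= (MK / h) k, which keeps one factor [k] to be averaged. The division by
   [1 + V] is retained only in the first-order coefficient [c1]. *)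
pose c1 := 2 * gam / (1 + V); pose c2 := gam ^+ 2 * (MK / h).
have c10 : 0 <= c1 by rewrite /c1 divr_ge0 ?mulr_ge0 ?(ltW gam0)//; lra.
have c20 : 0 <= c2 by rewrite /c2 mulr_ge0 ?sqr_ge0// divr_ge0// ltW.
have pw w : ln (1 + V' w) <= ln (1 + V) + c1 * (k (X w) * f (Y w)) + c2 * k (X w).
  have V'0 : 0 <= V' w by exact: sqr_ge0.
  apply: (le_trans (lnD1_tangent _ _ V0 V'0)).
  rewrite -addrA lerD2l.
  have V'E : V' w - V <= 2 * gam * (k (X w) * f (Y w)) + c2 * k (X w).
    rewrite /V' /V /D -addrA [_ - m]addrC addrA (sqr_normD Hip) (ipZr Hip).
    rewrite (ipC Hip (z - m)) -/(f (Y w)) normrZ exprMn.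
    rewrite real_normK ?num_real//.
    have u1 : `|unitv ((Y w : H) - z)| ^+ 2 <= 1.
      by rewrite expr_le1// norm_unitv_le1.
    have : (gam * k (X w)) ^+ 2 * `|unitv ((Y w : H) - z)| ^+ 2 <= c2 * k (X w).
      apply: (@le_trans _ _ ((gam * k (X w)) ^+ 2)).
        by rewrite -[leRHS]mulr1 ler_wpM2l// sqr_ge0.
      rewrite exprMn /c2 -mulrA ler_wpM2l ?sqr_ge0// expr2.
      by rewrite ler_wpM2r.
    lra.
  rewrite ler_pdivrMr; last lra.
  apply: (le_trans V'E).
  have -> : (c1 * (k (X w) * f (Y w)) + c2 * k (X w)) * (1 + V) =
      2 * gam * (k (X w) * f (Y w)) + c2 * k (X w) + c2 * k (X w) * V.
    by rewrite /c1; field; rewrite gt_eqF//; lra.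
  by rewrite lerDl; apply: mulr_ge0 => //; exact: mulr_ge0.
have mZ : measurable_fun setT ((fun w =>
    z + (gam * k (X w)) *: unitv ((Y w : H) - z) - m) : Omega -> borelType H).
  have mc (c : H) : measurable_fun setT ((fun=> c) : Omega -> borelType H).
    exact: measurable_cst.
  apply: (measurable_subv Hsep _ _ _ (mc m)).
  apply: (measurable_addv Hsep _ _ (mc z)).
  apply: (measurable_scalev Hsep); first exact: measurable_funM.
  by apply: (measurable_unitv Hsep); apply: (measurable_subv Hsep _ _ mY (mc z)).
have mV' : measurable_fun setT V'.
  by apply: measurable_funX; exact: measurable_normv.
have lnV0 w : 0 <= ln (1 + V' w) by rewrite ln_ge0// lerDl sqr_ge0.
pose ub w := ln (1 + V) + c1 * (k (X w) * f (Y w)) + c2 * k (X w).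
have i1 : P.-integrable setT (EFin \o (fun w => c1 * (k (X w) * f (Y w)))).
  by have := integrableZl measurableT c1 ikf.
have i2 : P.-integrable setT (EFin \o (fun w => c2 * k (X w))).
  by have := integrableZl measurableT c2 ik.
have i0 : P.-integrable setT (EFin \o (fun w : Omega => ln (1 + V))).
  exact: (iP (cst (ln (1 + V))) `|ln (1 + V)|).
have i01 : P.-integrable setT (EFin \o (fun w => ln (1 + V) + c1 * (k (X w) * f (Y w)))).
  by have := integrableD measurableT i0 i1.
have iub : P.-integrable setT (EFin \o ub) by have := integrableD measurableT i01 i2.
have iln : P.-integrable setT (EFin \o (fun w => ln (1 + V' w))).
  apply: (le_integrable measurableT _ _ iub).
    apply/measurable_EFinP; apply: measurableT_comp => //; exact: measurable_funD.
  move=> w _; rewrite /= lee_fin (ger0_norm (lnV0 w)).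
  by rewrite (ger0_norm (le_trans (lnV0 w) (pw w))); exact: pw.
have -> : \int[P]_w ln (1 + `|z + (gam * h^-1 * K ((X w - x) / h)) *:
    unitv ((Y w : H) - z) - m| ^+ 2) = \int[P]_w ln (1 + V' w).
  by apply: eq_Rintegral => w _; rewrite /V' /k mulrA.
apply: (@le_trans _ _ (\int[P]_w ub w)).
  by apply: le_Rintegral => // w _; exact: pw.
have -> : \int[P]_w ub w = ln (1 + V) + c1 * (\int[P]_w (k (X w) * f (Y w))) +
    c2 * \int[P]_w k (X w).
  rewrite (RintegralD measurableT i01 i2) (RintegralD measurableT i0 i1).
  by rewrite (RintegralZl _ measurableT ikf) (RintegralZl _ measurableT ik)
    Rintegral_probability_cst.
have h1 := ler_wpM2l c10 Ekf; have h2 := ler_wpM2l c20 Ek.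
(* The distance [D] left over from (A3) disappears because 2 D <= 1 + D^2. *)
have h3 : c1 * (C3 * (rho * h) `^ beta * D) <= C3 * rho `^ beta * (gam * h `^ beta).
  rewrite powRM ?(ltW h0)//.
  set rb := rho `^ beta; set hb := h `^ beta.
  have e0 : 0 <= C3 * rb * (gam * hb) by rewrite !mulr_ge0 ?powR_ge0// ltW.
  have -> : c1 * (C3 * (rb * hb) * D) = C3 * rb * (gam * hb) * (2 * D / (1 + V)).
    by rewrite /c1; field; rewrite gt_eqF//; lra.
  rewrite -[leRHS]mulr1 ler_wpM2l// ler_pdivrMr; last lra.
  have := sqr_ge0 (D - 1); rewrite sqrrB1 -/V -mulr_natl; lra.
have h4 : c2 * Mp = MK * Mp * (gam ^+ 2 / h) by rewrite /c2; field.
rewrite -/D -/V /step_error.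
have h5 : c1 * (p x * \int[mu x]_y f y) =
   - (2 * gam * (p x * - \int[mu x]_y ip (unitv (y - z)) (z - m)) / (1 + V)).
  rewrite /f /c1; ring.
move: h1; rewrite mulrDr; lra.
Qed.

End one_step.

(** * Almost-supermartingales *)

Section almost_supermartingale.
Context {R : realType} {d : measure_display} {Omega : measurableType d}
  {P : probability Omega R}.
Variables (Q : nat -> Omega -> R) (F : nat -> set (set Omega)) (c gam B : nat -> R).
Hypotheses (FI : forall n, setI_closed (F n)) (FU : forall n, setU_closed (F n))
  (FC : forall n A, F n A -> F n (~` A)) (FS : forall n, F n `<=` F n.+1)
  (Flt : forall n a, F n [set w | Q n w < a])
  (Q0 : forall n w, 0 <= Q n w) (mQ : forall n, measurable_fun setT (Q n))
  (Fm : forall n, F n `<=` measurable)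
  (QB : forall n w, Q n w <= B n).
(** Integrated form of the conditional inequality: testing against events of the past replaces
    conditional expectation. The error [c n] is deterministic and need not be weighted by the
    measure of [A]. *)
Hypothesis (step : forall n A, F n A ->
    \int[P]_w (\1_A w * Q n.+1 w) <= \int[P]_w (\1_A w * Q n w) + c n).

Let Fge n a : F n [set w | a <= Q n w].
Proof.
have -> : [set w | a <= Q n w] = ~` [set w | Q n w < a].
  by apply/seteqP; split => w /=; rewrite leNgt => /negP.
exact/FC/Flt.
Qed.

Let iQ n A : measurable A -> P.-integrable setT (EFin \o (fun w => \1_A w * Q n w)).
Proof.
move=> mA; apply: (bounded_integrable P _ (B n)).
  by apply: measurable_funM => //; exact: measurable_indic.
move=> w; rewrite normrM (ger0_norm (Q0 n w)) ger0_norm//.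
by rewrite -[leRHS]mul1r ler_pM// indicE lern1 leq_b1.
Qed.

Let indic_bool (b : Omega -> bool) w : \1_[set w | b w] w = (b w)%:R :> R.
Proof.
by rewrite indicE; congr (nat_of_bool _)%:R; apply/idP/idP => [/set_mem|/mem_set].
Qed.

Section maximal_inequality.
Variables (N : nat) (eps del : R).
Hypotheses (eps0 : 0 <= eps) (del0 : 0 <= del).

(* From time [N] on, the path waits ([waiting]) for [Q] to drop below [eps];
   it is then [active] until [Q] reaches [del]. *)
Fixpoint waiting j w : bool :=
  if j is i.+1 then waiting i w && (eps <= Q (N + j) w) else eps <= Q N w.

Fixpoint active j w : bool :=
  if j is i.+1 then (active i w && (Q (N + j) w < del)) ||
                    (waiting i w && (Q (N + j) w < eps))
  else Q N w < eps.

(** Stopped potential: [eps] while waiting, [Q] while active, and [del] after the crossing. Freezing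
    it at [del] instead of the value actually reached means that an overshoot only decreases it. *)
Let pot j w := if active j w then Q (N + j) w else if waiting j w then eps else del.

Let Fwaiting j : F (N + j) [set w | waiting j w].
Proof.
elim: j => [|j ih] /=; first by rewrite addn0; exact: Fge.
have -> : [set w | waiting j w && (eps <= Q (N + j.+1) w)] =
    [set w | waiting j w] `&` [set w | eps <= Q (N + j.+1) w].
  by apply/seteqP; split => w /= => [/andP[]|[-> ->]].
by apply: FI; [rewrite addnS; exact: FS|exact: Fge].
Qed.

Let Factive j : F (N + j) [set w | active j w].
Proof.
elim: j => [|j ih] /=; first by rewrite addn0; exact: Flt.
have -> : [set w | (active j w && (Q (N + j.+1) w < del)) ||
      (waiting j w && (Q (N + j.+1) w < eps))] =
    ([set w | active j w] `&` [set w | Q (N + j.+1) w < del]) `|`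
    ([set w | waiting j w] `&` [set w | Q (N + j.+1) w < eps]).
  apply/seteqP; split => w /=.
    by move=> /orP[/andP[-> ->]|/andP[-> ->]]; [left|right].
  by move=> [[-> ->]|[-> ->]]; rewrite ?orbT.
have Fw := Fwaiting j; apply: FU; apply: FI => //; rewrite addnS; exact: FS.
Qed.

Let not_both j w : active j w -> ~~ waiting j w.
Proof.
elim: j => [|j ih] /=; first by rewrite -ltNge.
move=> /orP[/andP[/ih/negPf -> _]|/andP[_]]//.
by rewrite ltNge => /negPf ->; rewrite andbF.
Qed.

(** Becoming active replaces [eps] by a smaller value of [Q], and crossing replaces a value at least
    [del] by [del]; only increments of [Q] while active can raise the potential. *)
Let pot_step j w :
  pot j.+1 w <= pot j w + \1_[set w | active j w] w * (Q (N + j.+1) w - Q (N + j) w).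
Proof.
rewrite /pot indic_bool /=; have := @not_both j w.
case: (active j w) => /=.
  move=> /(_ isT)/negPf -> /=; rewrite orbF mulr1n mul1r addrC subrK.
  by case: ifPn => //; rewrite -leNgt.
move=> _; rewrite mulr0n mul0r addr0.
case: (waiting j w) => //=.
by case: ltP => // /ltW.
Qed.

Let mactive j : measurable [set w | active j w]. Proof. exact/Fm/Factive. Qed.
Let mwaiting j : measurable [set w | waiting j w]. Proof. exact/Fm/Fwaiting. Qed.

Let pot0 j w : 0 <= pot j w.
Proof. by rewrite /pot; case: ifP => // _; case: ifP. Qed.

Let potE j w : pot j w = \1_[set w | active j w] w * Q (N + j) w +
  (\1_([set w | ~~ active j w && waiting j w]) w * eps +
   \1_([set w | ~~ active j w && ~~ waiting j w]) w * del).
Proof.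
rewrite /pot !indic_bool /=.
by case: (active j w); case: (waiting j w) => /=;
  rewrite ?mulr1n ?mulr0n ?mul1r ?mul0r ?addr0 ?add0r.
Qed.

Let mhit j : measurable [set w | ~~ active j w && ~~ waiting j w].
Proof.
have -> : [set w | ~~ active j w && ~~ waiting j w] =
    ~` [set w | active j w] `&` ~` [set w | waiting j w].
  by apply/seteqP; split => w /= => [/andP[/negP ? /negP]|[/negP -> /negP ->]].
by apply: measurableI; exact: measurableC.
Qed.

Let ipot j : P.-integrable setT (EFin \o pot j).
Proof.
apply: (bounded_integrable P _ (B (N + j) + (eps + del))).
  rewrite (funext (potE j)).
  have mw : measurable [set w | ~~ active j w && waiting j w].
    have -> : [set w | ~~ active j w && waiting j w] =
        ~` [set w | active j w] `&` [set w | waiting j w].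
      by apply/seteqP; split => w /= => [/andP[/negP]|[/negP -> ->]].
    by apply: measurableI => //; exact: measurableC.
  apply: measurable_funD; first by apply: measurable_funM => //; exact: measurable_indic.
  by apply: measurable_funD; apply: measurable_funM => //; exact: measurable_indic.
move=> w; rewrite ger0_norm// /pot.
have QBw := QB (N + j) w; have Q0w := Q0 (N + j) w.
by have e0 := eps0; have d0 := del0; case: ifP => _; [|case: ifP => _]; lra.
Qed.

Let Epot j : \int[P]_w pot j w <= eps + \sum_(i < j) c (N + i).
Proof.
elim: j => [|j ih].
  rewrite big_ord0 addr0 -[leRHS](Rintegral_probability_cst P).
  apply: le_Rintegral => //; first exact: (bounded_integrable P (cst eps) `|eps|).
  move=> w _; rewrite /pot addn0 /=.
  by case: ltP => // /ltW.
rewrite big_ord_recr /= addrA.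
have i1 := iQ (N + j.+1) _ (mactive j); have i2 := iQ (N + j) _ (mactive j).
have i3 : P.-integrable setT (EFin \o (fun w =>
    \1_[set w | active j w] w * Q (N + j.+1) w - \1_[set w | active j w] w * Q (N + j) w)).
  by have := integrableB measurableT i1 i2.
apply: (@le_trans _ _ (\int[P]_w (pot j w + (\1_[set w | active j w] w * Q (N + j.+1) w -
    \1_[set w | active j w] w * Q (N + j) w)))).
  apply: le_Rintegral => //; first by have := integrableD measurableT (ipot j) i3.
  by move=> w _; rewrite -mulrBr; exact: pot_step.
rewrite (RintegralD measurableT (ipot j) i3) lerD// (RintegralB measurableT i1 i2).
by rewrite lerBlDl addnS; exact: step.
Qed.

Definition hitting : set Omega :=
  \bigcup_j [set w | ~~ active j w && ~~ waiting j w].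

Lemma measurable_hitting : measurable hitting.
Proof. exact: bigcupT_measurable. Qed.

(** At time [n] the path is no longer waiting. Without a crossing it would be active at [n] and at
    all later times, which [del <= Q k w] forbids at time [k]. *)
Lemma hittingP n k w : (N <= n)%N -> (n < k)%N -> Q n w < eps -> del <= Q k w ->
  hitting w.
Proof.
move=> Nn nk Qn Qk; apply: contrapT => noth.
have nh j : active j w || waiting j w.
  by apply: contrapT => /negP; rewrite negb_or => h; apply: noth; exists j.
have an : active (n - N) w.
  have := nh (n - N)%N; case: (active _ _) => //= wn.
  have : eps <= Q n w.
    move: wn; case E : (n - N)%N => [|j] /=.
      by have -> : N = n by apply/eqP; rewrite eqn_leq Nn -subn_eq0 E.
    by rewrite -E subnKC// => /andP[].
  by rewrite leNgt Qn.
have ak j : active (n - N + j) w.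
  elim: j => [|j ih]; first by rewrite addn0.
  have := nh (n - N + j.+1)%N; rewrite addnS /=.
  by rewrite (negPf (not_both _ _ ih)) /= !orbF.
have := ak (k - n)%N.
have -> : (n - N + (k - n) = (k - N).-1.+1)%N.
  by rewrite prednK ?subn_gt0 ?(leq_ltn_trans Nn)// addnC addnBA// subnK// ltnW.
rewrite /= prednK ?subn_gt0 ?(leq_ltn_trans Nn)// subnKC ?(leq_trans Nn (ltnW nk))//.
have am : active (k - N).-1 w.
  have -> : ((k - N).-1 = n - N + (k - n).-1)%N.
    have := nk; have := Nn; case: k {Qk nk} => // k Nn'; rewrite ltnS => nk.
    by rewrite !subSn// ?(leq_trans Nn)//= addnC addnBA// subnK.
  exact: ak.
by rewrite (negPf (not_both _ _ am)) am /= orbF ltNge Qk.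
Qed.

(** Doob-type inequality: the potential equals [del] on paths that have crossed by time [j], and its
    mean is at most [eps] plus the accumulated errors. The crossing events increase with [j], so
    continuity from below passes to their union. *)
Lemma probability_hitting S : (forall j, \sum_(i < j) c (N + i) <= S) ->
  del * fine (P hitting) <= eps + S.
Proof.
move=> cS.
have hj j : del * fine (P [set w | ~~ active j w && ~~ waiting j w]) <= eps + S.
  apply: (@le_trans _ _ (\int[P]_w pot j w)); last first.
    by apply: (le_trans (Epot j)); rewrite lerD2l.
  have -> : del * fine (P [set w | ~~ active j w && ~~ waiting j w]) =
      \int[P]_w (\1_[set w | ~~ active j w && ~~ waiting j w] w * del).
    rewrite RintegralZr//; last exact: integrable_indic.
    by rewrite mulrC /Rintegral integral_indic// setIT.
  apply: le_Rintegral => //.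
    apply: (bounded_integrable P _ del).
      by apply: measurable_funM => //; exact: measurable_indic.
    move=> w; rewrite normrM (ger0_norm del0) ger0_norm//.
    by rewrite -[leRHS]mul1r ler_wpM2r// indicE lern1 leq_b1.
  move=> w _; rewrite /pot indic_bool /=.
  by case: (active j w); case: (waiting j w) => /=; rewrite ?mulr0n ?mulr1n ?mul0r ?mul1r.
have [->|dn0] := eqVneq del 0.
  rewrite mul0r addr_ge0//; by have := cS 0%N; rewrite big_ord0.
have dp : 0 < del by rewrite lt_neqAle eq_sym dn0.
rewrite mulrC -ler_pdivlMr// -lee_fin fineK ?fin_num_measure//; last exact: measurable_hitting.
have nd : nondecreasing_seq (fun j => [set w | ~~ active j w && ~~ waiting j w]).
  apply/nondecreasing_seqP => j; apply/subsetPset => w /= /andP[/negPf -> /negPf ->].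
  by [].
have cv := nondecreasing_cvg_mu (mu := P) mhit measurable_hitting nd.
rewrite -(cvg_lim _ cv)//; apply: lime_le; first by apply/cvg_ex; eexists; exact: cv.
apply: nearW => j /=; rewrite -[X in (X <= _)%E]fineK ?fin_num_measure// lee_fin.
by rewrite ler_pdivlMr// mulrC.
Qed.

End maximal_inequality.

Variable S : R.
Hypotheses (gam0 : forall n, 0 <= gam n)
  (drift : forall eps lam, 0 < eps -> exists2 kap, 0 < kap & forall n,
    \int[P]_w Q n.+1 w <= \int[P]_w Q n w + c n -
      gam n * kap * fine (P [set w | eps <= Q n w < lam]))
  (sumc : forall n, \sum_(i < n) c i <= S)
  (tailc : forall e, 0 < e -> exists N, forall j, \sum_(i < j) c (N + i)%N <= e)
  (sumgam : forall M, exists n, M <= \sum_(i < n) gam i).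

Let mlevel n eps lam : measurable [set w | eps <= Q n w < lam].
Proof.
have -> : [set w | eps <= Q n w < lam] =
    [set w | eps <= Q n w] `&` [set w | Q n w < lam].
  by apply/seteqP; split => w /= => [/andP[]|[-> ->]].
by apply: measurableI; apply: Fm; [exact: Fge|exact: Flt].
Qed.

Let stay N eps lam := \bigcap_(n in [set n | (N <= n)%N]) [set w | eps <= Q n w < lam].

Let mstay N eps lam : measurable (stay N eps lam).
Proof. by apply: bigcap_measurable => //; exists N => /=. Qed.

(** Summing the drift inequality bounds [kap] times the sum of [gam i * pE i] by [B 0 + S]. From
    time [N] on each [pE i] is at least the probability [q] of staying, so a positive [q]
    contradicts the divergence of the sum of [gam]. *)
Let stay_null N eps lam : 0 < eps -> fine (P (stay N eps lam)) = 0.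
Proof.
move=> e0; have [kap kap0 kapP] := drift eps lam e0.
set q := fine _; pose pE i := fine (P [set w | eps <= Q i w < lam]).
have q0 : 0 <= q by exact: fine_ge0.
have pE0 i : 0 <= pE i by exact: fine_ge0.
have qpE i : (N <= i)%N -> q <= pE i.
  move=> Ni; apply: fine_le; rewrite ?fin_num_measure//.
  by apply: le_measure; [exact: mem_set..|move=> w; apply].
have B0 : 0 <= B 0 by apply: le_trans (QB 0 point).
have S0 : 0 <= S by have := sumc 0; rewrite big_ord0.
have tele n : \int[P]_w Q n w + kap * \sum_(i < n) gam i * pE i <=
    B 0 + \sum_(i < n) c i.
  elim: n => [|n ih].
    rewrite !big_ord0 mulr0 !addr0 -[leRHS](Rintegral_probability_cst P).
    apply: le_Rintegral => //.
    - apply: (bounded_integrable P _ (B 0)) => // w; by rewrite ger0_norm.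
    - by apply: (bounded_integrable P (cst (B 0)) (B 0)) => // w; rewrite ger0_norm.
  by rewrite !big_ord_recr /=; have := kapP n; rewrite -/(pE n); lra.
have lbd n : q * (\sum_(i < n) gam i - \sum_(i < N) gam i) <= \sum_(i < n) gam i * pE i.
  have mono a b : (a <= b)%N -> \sum_(i < a) gam i <= \sum_(i < b) gam i.
    move=> ab; rewrite -(subnK ab) addnC big_split_ord /= lerDl.
    by apply: sumr_ge0 => i _; exact: gam0.
  have [nN|Nn] := leqP n N.
    apply: (@le_trans _ _ 0); last by apply: sumr_ge0 => i _; rewrite mulr_ge0.
    by rewrite mulr_ge0_le0// subr_le0 mono.
  rewrite -(subnKC (ltnW Nn)) !big_split_ord /= addrAC subrr add0r.
  apply: (@le_trans _ _ (\sum_(i < n - N) gam (N + i)%N * pE (N + i)%N)).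
    by rewrite mulr_sumr ler_sum// => i _; rewrite mulrC ler_wpM2l// qpE// leq_addr.
  by rewrite lerDr; apply: sumr_ge0 => i _; rewrite mulr_ge0.
apply/eqP; rewrite eq_le q0 andbT leNgt; apply/negP => qp.
have kq : 0 < kap * q by exact: mulr_gt0.
have [n] := sumgam (\sum_(i < N) gam i + (B 0 + S + 1) / (kap * q)).
rewrite -lerBrDl ler_pdivrMr// => hn.
have := ler_wpM2l (ltW kap0) (lbd n); have := tele n; have := sumc n.
have : 0 <= \int[P]_w Q n w by apply: Rintegral_ge0.
lra.
Qed.

Lemma almost_supermartingale_limsup del : 0 < del ->
  P (lim_sup_set (fun n => [set w | del <= Q n w])) = 0%E.
Proof.
move=> del0; set Bad := lim_sup_set _.
have mlev n : measurable [set w | del <= Q n w] by apply: Fm; exact: Fge.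
have mBad : measurable Bad.
  by apply: bigcapT_measurable => n; apply: bigcup_measurable => k _.
have B0 : 0 <= B 0 by apply: le_trans (QB 0 point).
have S0 : 0 <= S by have := sumc 0; rewrite big_ord0.
suff : fine (P Bad) <= 0.
  rewrite -lee_fin fineK ?fin_num_measure// => le0.
  by apply/eqP; rewrite eq_le le0 measure_ge0.
apply/ler_addgt0Pr => eta eta0; rewrite add0r.
(* Three shares of [eta]: one for exceeding [lam], two for recrossing [del]. The level [lam] is
   large enough that (B 0 + 1 + S) / lam <= [et], and both [eps] and the tail of the errors after
   [N] are at most [et * del]. *)
pose et := eta / 3.
have et0 : 0 < et by rewrite divr_gt0.
pose lam := B 0 + 1 + (B 0 + 1 + S) / et.
have lam1 : B 0 + 1 <= lam by rewrite lerDl divr_ge0 ?(ltW et0)//; lra.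
have lam0 : 0 < lam by lra.
have [N tailN] := tailc _ (mulr_gt0 et0 del0).
pose eps := et * del.
have eps0 : 0 < eps by exact: mulr_gt0.
(* The level [B 0 + 1] exceeds [Q 0] everywhere, so the path is active from time 0 and [T1] is the
   event of ever reaching [lam]. *)
pose T1 := hitting 0 (B 0 + 1) lam.
pose T3 := hitting N eps del.
have sub : Bad `<=` T1 `|` (stay N eps lam `|` T3).
  move=> w Bw; have [T1w|nT1] := pselect (T1 w); first by left.
  have below n : Q n w < lam.
    rewrite ltNge; apply/negP => ge; apply: nT1.
    case: n ge => [|n] ge; first by have := QB 0 w; lra.
    by apply: (hittingP 0 _ _ 0 n.+1) => //; have := QB 0 w; lra.
  right; have [|nst] := pselect (stay N eps lam w); first by left.
  right; move: nst => /existsNP[n /not_implyP[/= Nn]].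
  rewrite below andbT => /negP; rewrite -ltNge => Qn.
  (* The limsup event is read at [n.+1] because the crossing time must lie strictly after the visit
     below [eps]. *)
  have [k /= nk Qk] := Bw n.+1 I.
  exact: (hittingP _ _ _ n k).
have mT1 : measurable T1 by exact: measurable_hitting.
have mT3 : measurable T3 by exact: measurable_hitting.
have pT1 : fine (P T1) <= et.
  have : lam * fine (P T1) <= (B 0 + 1) + S.
    by apply: probability_hitting => //; [lra|exact: ltW].
  move=> h; rewrite -(ler_pM2l lam0); apply: (le_trans h).
  rewrite /lam mulrDl divfK ?gt_eqF//; have := mulr_ge0 B0 (ltW et0); lra.
have pT3 : fine (P T3) <= et + et.
  have : del * fine (P T3) <= eps + et * del.
    by apply: probability_hitting => //; exact: ltW.
  by move=> h; rewrite -(ler_pM2l del0); move: h; rewrite /eps; lra.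
have : fine (P Bad) <= fine (P T1) + (fine (P (stay N eps lam)) + fine (P T3)).
  rewrite -lee_fin !EFinD !fineK ?fin_num_measure//.
  apply: (@le_trans _ _ (P (T1 `|` (stay N eps lam `|` T3)))).
    apply: le_measure => //; apply: mem_set => //.
    by apply: measurableU => //; exact: measurableU.
  apply: (le_trans (measureU2 _ _ _)) => //; first exact: measurableU.
  by rewrite leeD2l// measureU2.
by rewrite stay_null// /et in pT1 pT3 *; lra.
Qed.

Lemma almost_supermartingale_cvg0 : {ae P, forall w, Q n w @[n --> \oo] --> (0 : R)}.
Proof.
pose N := \bigcup_j lim_sup_set (fun n => [set w | j.+1%:R^-1 <= Q n w]).
have negN : P.-negligible N.
  apply: negligible_bigcup => j.
  exists (lim_sup_set (fun n => [set w | j.+1%:R^-1 <= Q n w])); split => //.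
  - apply: bigcapT_measurable => n; apply: bigcup_measurable => k _.
    by apply: Fm; exact: Fge.
  - by apply: almost_supermartingale_limsup; rewrite invr_gt0.
apply: negligibleS negN => w /= ncv; apply: contrapT => nN; apply: ncv.
apply/cvgrPdist_lt => e e0.
have ej : (Num.truncn e^-1).+1%:R^-1 < e.
  by rewrite invf_plt ?posrE//; exact: truncnS_gt.
apply: contrapT => nev; apply: nN; exists (Num.truncn e^-1) => // n _.
apply: contrapT => nex; apply: nev; exists n => // k /= nk.
rewrite sub0r normrN ger0_norm// ltNge; apply/negP => eQ; apply: nex.
by exists k => //=; exact: le_trans (ltW ej) eQ.
Qed.

End almost_supermartingale.

(** * The stochastic algorithm *)

Section series.
Context {R : realType}.
Implicit Type u : nat -> R.

Lemma nneseries_partial_bound u : (forall n, 0 <= u n) ->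
  (\sum_(n <oo) (u n)%:E < +oo)%E -> exists S, forall n, \sum_(i < n) u i <= S.
Proof.
move=> u0 su; exists (fine (\sum_(n <oo) (u n)%:E)%E) => n.
have s0 : (0 <= \sum_(n <oo) (u n)%:E)%E by apply: nneseries_ge0 => k _ _; rewrite lee_fin.
rewrite -lee_fin fineK; last by rewrite ge0_fin_numE.
rewrite -sumEFin -(big_mkord xpredT (fun i => (u i)%:E)).
by apply: nneseries_lim_ge => k _ _; rewrite lee_fin.
Qed.

Lemma partial_bound_tail u S : (forall n, 0 <= u n) ->
  (forall n, \sum_(i < n) u i <= S) ->
  forall e, 0 < e -> exists N, forall j, \sum_(i < j) u (N + i)%N <= e.
Proof.
move=> u0 uS e e0; pose A := range (fun n => \sum_(i < n) u i).
have hA : has_sup A by split; [exists (\sum_(i < 0) u i), 0%N|exists S => _ [n _ <-]].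
have [_ [N _ <-] hN] := sup_adherent e0 hA.
exists N => j.
have : \sum_(i < N + j) u i <= sup A by apply: ub_le_sup; [case: hA|exists (N + j)%N].
rewrite big_split_ord /=; move: hN; lra.
Qed.

Lemma nneseries_pinfty_partial u : (\sum_(n <oo) (u n)%:E = +oo)%E ->
  (forall n, 0 <= u n) -> forall M, exists n, M <= \sum_(i < n) u i.
Proof.
move=> su u0 M; apply: contrapT => nM.
have : (\sum_(n <oo) (u n)%:E <= M%:E)%E.
  apply: lime_le; first by apply: is_cvg_nneseries => k _ _; rewrite lee_fin.
  apply: nearW => n; rewrite big_mkord sumEFin lee_fin leNgt; apply/negP => lt.
  by apply: nM; exists n; exact: ltW.
by rewrite su leye_eq.
Qed.

End series.

(** * The history and the newest observation *)

Section filtration.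
Context {R : realType} {H : normedModType R} {d : measure_display}
  {Omega : measurableType d} {P : probability Omega R}.
Variables (X : nat -> Omega -> R) (Y : nat -> Omega -> borelType H).
Hypotheses (mX : forall n, measurable_fun setT (X n))
  (mY : forall n, measurable_fun setT (Y n)) (Hindep : indep_pairs P X Y).

(** Finite rectangles in the observations of index 0 to [n]: a family closed under intersection, in
    the form that [indep_pairs] evaluates. It generates the sigma-algebra for which [Zalg] at [n] is
    measurable. *)
Definition past n : set (set Omega) :=
  [set E | exists A B, [/\ forall i, measurable (A i : set R),
    forall i, measurable (B i : set (borelType H)) &
    E = \bigcap_(i in [set` iota 0 n.+1]) (X i @^-1` A i `&` Y i @^-1` B i)]].

Definition newest n : set (set Omega) :=
  [set E | exists A B, [/\ measurable (A : set R), measurable (B : set (borelType H)) &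
    E = X n.+1 @^-1` A `&` Y n.+1 @^-1` B]].

Let mXY i (A : set R) (B : set (borelType H)) : measurable A -> measurable B ->
  measurable (X i @^-1` A `&` Y i @^-1` B).
Proof.
move=> mA mB; apply: measurableI.
  by rewrite -[Z in measurable Z]setTI; exact: mX.
by rewrite -[Z in measurable Z]setTI; exact: mY.
Qed.

Lemma past_measurable n : past n `<=` measurable.
Proof.
move=> _ [A [B [mA mB ->]]]; apply: fin_bigcap_measurable => //.
by move=> i _; exact: mXY.
Qed.

Lemma newest_measurable n : newest n `<=` measurable.
Proof. by move=> _ [A [B [mA mB ->]]]; exact: mXY. Qed.

Lemma past_setI n : setI_closed (past n).
Proof.
move=> _ _ [A [B [mA mB ->]]] [A' [B' [mA' mB' ->]]].
exists (fun i => A i `&` A' i), (fun i => B i `&` B' i); split.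
- by move=> i; exact: measurableI.
- by move=> i; exact: measurableI.
- rewrite -bigcapI; apply: eq_bigcapr => i _.
  by rewrite !preimage_setI setIACA.
Qed.

Lemma newest_setI n : setI_closed (newest n).
Proof.
move=> _ _ [A [B [mA mB ->]]] [A' [B' [mA' mB' ->]]].
exists (A `&` A'), (B `&` B'); split; [exact: measurableI..|].
by rewrite !preimage_setI setIACA.
Qed.

Lemma past_preimage n i (A : set R) (B : set (borelType H)) : (i <= n)%N ->
  measurable A -> measurable B -> past n (X i @^-1` A `&` Y i @^-1` B).
Proof.
move=> lein mA mB.
exists (fun j => if j == i then A else setT), (fun j => if j == i then B else setT).
split; [by move=> j; case: ifP|by move=> j; case: ifP|].
apply/seteqP; split => w /=.
  by move=> [wA wB] j _; case: eqP => [->|].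
have iI : i \in iota 0 n.+1 by rewrite mem_iota.
by move=> /(_ i iI); rewrite eqxx.
Qed.

Lemma past_setT n : past n setT.
Proof.
have := @past_preimage n 0 setT setT (leq0n n) measurableT measurableT.
by rewrite !preimage_setT setIT.
Qed.

Lemma newest_setT n : newest n setT.
Proof. by exists setT, setT; split => //; rewrite !preimage_setT setIT. Qed.

Lemma pastS n : past n `<=` past n.+1.
Proof.
move=> _ [A [B [mA mB ->]]].
exists (fun j => if (j <= n)%N then A j else setT), (fun j => if (j <= n)%N then B j else setT).
split; [by move=> j; case: ifP|by move=> j; case: ifP|].
apply/seteqP; split => w h j /=.
  move=> _; case: leqP => // jn.
  have jI : j \in iota 0 n.+1 by rewrite mem_iota.
  exact: h j jI.
move=> jI; have jn : (j <= n)%N by move: jI; rewrite (mem_iota 0 n.+1).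
have jI' : j \in iota 0 n.+2 by rewrite mem_iota /= add0n ltnS (leq_trans jn).
by have := h j jI'; rewrite jn.
Qed.

Lemma sigma_past_sub n : <<s past n >> `<=` <<s past n.+1 >>.
Proof. exact: sub_sigma_algebra2 (@pastS n). Qed.

(** The two rectangles are merged into one family of sets indexed by 0 to n+1; independence for the
    lists of n+2 and of n+1 indices then gives products that differ by the last factor. *)
Lemma past_newest_indep n A B : past n A -> newest n B -> P (A `&` B) = (P A * P B)%E.
Proof.
move=> [A1 [B1 [mA1 mB1 ->]]] [A2 [B2 [mA2 mB2 ->]]].
pose A' i := if i == n.+1 then A2 else A1 i.
pose B' i := if i == n.+1 then B2 else B1 i.
have mA' i : measurable (A' i) by rewrite /A'; case: ifP.
have mB' i : measurable (B' i) by rewrite /B'; case: ifP.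
have E1 : \bigcap_(i in [set` iota 0 n.+1]) (X i @^-1` A1 i `&` Y i @^-1` B1 i) =
    \bigcap_(i in [set` iota 0 n.+1]) (X i @^-1` A' i `&` Y i @^-1` B' i).
  apply: eq_bigcapr => i iI; have ilt : (i < n.+1)%N by move: iI; rewrite /mkset mem_iota.
  by rewrite /A' /B' ltn_eqF.
have E2 : X n.+1 @^-1` A2 `&` Y n.+1 @^-1` B2 = X n.+1 @^-1` A' n.+1 `&` Y n.+1 @^-1` B' n.+1.
  by rewrite /A' /B' eqxx.
have E3 : \bigcap_(i in [set` iota 0 n.+1]) (X i @^-1` A' i `&` Y i @^-1` B' i) `&`
    (X n.+1 @^-1` A' n.+1 `&` Y n.+1 @^-1` B' n.+1) =
    \bigcap_(i in [set` iota 0 n.+2]) (X i @^-1` A' i `&` Y i @^-1` B' i).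
  have iE i : (i \in iota 0 n.+2) = (i \in iota 0 n.+1) || (i == n.+1).
    by rewrite -[n.+2]addn1 iotaD mem_cat add0n mem_seq1.
  apply/seteqP; split => w.
    by move=> [h1 h2] i; rewrite /mkset iE => /orP[/h1//|/eqP ->].
  move=> h; split; first by move=> i iI; apply: h; rewrite /mkset iE iI.
  by apply: h; rewrite /mkset iE eqxx orbT.
rewrite E1 E2 E3 !Hindep ?iota_uniq//.
by rewrite -[n.+2]addn1 iotaD big_cat add0n big_seq1.
Qed.

Lemma measurable_past_X n i : (i <= n)%N ->
  measurable_fun setT (X i : g_sigma_algebraType (past n) -> R).
Proof.
move=> lein _ A mA; rewrite setTI; apply: sub_sigma_algebra.
have := past_preimage _ _ _ _ lein mA (@measurableT _ (borelType H)).
by rewrite preimage_setT setIT.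
Qed.

Lemma measurable_past_Y n i : (i <= n)%N ->
  measurable_fun setT (Y i : g_sigma_algebraType (past n) -> borelType H).
Proof.
move=> lein _ B mB; rewrite setTI; apply: sub_sigma_algebra.
have := past_preimage _ _ _ _ lein (@measurableT _ R) mB.
by rewrite preimage_setT setTI.
Qed.

Lemma measurable_newest_X n :
  measurable_fun setT (X n.+1 : g_sigma_algebraType (newest n) -> R).
Proof.
move=> _ A mA; rewrite setTI; apply: sub_sigma_algebra.
by exists A, setT; split => //; rewrite preimage_setT setIT.
Qed.

Lemma measurable_newest_Y n :
  measurable_fun setT (Y n.+1 : g_sigma_algebraType (newest n) -> borelType H).
Proof.
move=> _ B mB; rewrite setTI; apply: sub_sigma_algebra.
by exists setT, B; split => //; rewrite preimage_setT setTI.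
Qed.

Lemma measurable_Zalg (K : R -> R) (gam h : nat -> R) (x : R) (z1 : H) n :
  separable_space H -> measurable_fun setT K ->
  measurable_fun setT (Zalg K gam h X (fun k o => (Y k o : H)) x z1 n :
    g_sigma_algebraType (past n) -> borelType H).
Proof.
move=> Hsep mK; elim: n => [|n ih] /=; first exact: measurable_cst.
have mZ : measurable_fun setT (Zalg K gam h X (fun k o => (Y k o : H)) x z1 n :
    g_sigma_algebraType (past n.+1) -> borelType H).
  by move=> _ B mB; have := ih measurableT B mB; rewrite !setTI; exact: sigma_past_sub.
apply: (measurable_addv Hsep _ _ mZ); apply: (measurable_scalev Hsep).
  apply: measurable_funM => //; apply: (measurableT_comp mK).
  by apply: measurable_funM => //; apply: measurable_funB => //; exact: measurable_past_X.
apply: (measurable_unitv Hsep); apply: (measurable_subv Hsep) => //.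
exact: measurable_past_Y.
Qed.

End filtration.

(** * The logarithmic potential over one step, given the past *)

Section conditional_step.
Context {R : realType} {H : completeNormedModType R} {ip : H -> H -> R}.
Hypotheses (Hip : is_inner_product ip) (Hsep : separable_space H).
Context {d : measure_display} {Omega : measurableType d} {P : probability Omega R}
  {X : nat -> Omega -> R} {Y : nat -> Omega -> borelType H}
  {p : R -> R} {mu : R -> probability (borelType H) R}.
Hypotheses (p0 : forall x, 0 <= p x) (mp : measurable_fun setT p)
  (Hlaw : forall n, joint_law P (X n) (Y n) p mu) (Hindep : indep_pairs P X Y).
Context {K : R -> R} {gam h : nat -> R} {beta C3 MK Mp rho : R}.
Hypotheses (gam0 : forall n, 0 < gam n) (h0 : forall n, 0 < h n)
  (A3 : forall (x x' : R) (alpha phi phi' : H),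
    is_Phi ip p mu x alpha phi -> is_Phi ip p mu x' alpha phi' ->
    `|phi - phi'| <= C3 * `|x - x'| `^ beta)
  (pM : forall x, p x <= Mp) (mK : measurable_fun setT K)
  (K0 : forall u, 0 <= K u) (KM : forall u, K u <= MK)
  (rho0 : 0 <= rho) (Krho : forall u, K u != 0 -> `|u| <= rho)
  (K1 : (\int[lebesgue_measure]_u (K u)%:E = 1)%E) (beta0 : 0 <= beta) (C30 : 0 <= C3).
Variables (x : R) (z1 m : H).

Local Notation Z := (Zalg K gam h X (fun k o => (Y k o : H)) x z1).

Definition lyap n w : R := ln (1 + `|Z n w - m| ^+ 2).

Let mX n : measurable_fun setT (X n). Proof. by case: (Hlaw n). Qed.
Let mY n : measurable_fun setT (Y n). Proof. by case: (Hlaw n). Qed.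

Lemma lyap_ge0 n w : 0 <= lyap n w.
Proof. by rewrite ln_ge0// lerDl sqr_ge0. Qed.

Lemma measurable_past_lyap n :
  measurable_fun setT (lyap n : g_sigma_algebraType (past X Y n) -> R).
Proof.
apply: measurableT_comp => //; apply: measurable_funD => //; apply: measurable_funX.
apply: (measurable_normv); apply: (measurable_subv Hsep).
  exact: (measurable_Zalg X Y).
exact: measurable_cst.
Qed.

Lemma sigma_past_measurable n : <<s past X Y n >> `<=` measurable.
Proof.
by apply: (smallest_sub (@sigma_algebra_measurable _ Omega)); exact: past_measurable.
Qed.

Lemma measurable_lyap n : measurable_fun setT (lyap n).
Proof.
by move=> _ A mA; apply: (sigma_past_measurable n); exact: measurable_past_lyap.
Qed.

Let norm_step_le n (z : H) s u : 0 <= s -> s <= gam n * (MK / h n) ->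
  `|z + s *: unitv u - m| <= `|z - m| + gam n * (MK / h n).
Proof.
move=> s0 sM; rewrite addrAC; apply: (le_trans (ler_normD _ _)).
rewrite lerD2l normrZ (ger0_norm s0); apply: le_trans sM.
by rewrite -[leRHS]mulr1 ler_wpM2l// norm_unitv_le1.
Qed.

Let coef_ge0 n t : 0 <= gam n * (h n)^-1 * K t.
Proof. by rewrite !mulr_ge0// ?invr_ge0 ltW. Qed.

Let coef_le n t : gam n * (h n)^-1 * K t <= gam n * (MK / h n).
Proof.
rewrite -mulrA ler_wpM2l ?(ltW (gam0 n))// mulrC.
by rewrite ler_wpM2r// invr_ge0 ltW.
Qed.

Let lnD1_le (a b : R) : 0 <= a -> a <= b -> ln (1 + a ^+ 2) <= b ^+ 2.
Proof.
move=> a0 ab; apply: (@le_trans _ _ (a ^+ 2)).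
  by apply: le_ln1Dx; have := sqr_ge0 a; lra.
by rewrite ler_pXn2r// nnegrE// (le_trans a0).
Qed.

(** Each move has length at most [gam n * (MK / h n)], so at a fixed time the iterate lies in a
    deterministic ball. The bound may grow with [n]; it serves only integrability. *)
Lemma Zalg_bounded n : exists C, forall w, `|Z n w - m| <= C.
Proof.
elim: n => [|n [C CP]]; first by exists `|z1 - m|.
exists (C + gam n * (MK / h n)) => w /=.
apply: (le_trans (norm_step_le n _ _ _ (coef_ge0 n _) (coef_le n _))).
by rewrite lerD2r.
Qed.

Lemma lyap_bounded n : exists C, forall w, lyap n w <= C.
Proof.
have [C CP] := Zalg_bounded n; exists (C ^+ 2) => w.
exact: lnD1_le.
Qed.

(* The new observation is independent of the past, so Fubini reduces the
   conditional expectation to [one_step_drift] at the frozen value of [Z n]. *)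
Lemma lyap_step n A (gl : Omega -> R) : <<s past X Y n >> A ->
  measurable_fun setT gl -> (forall w, 0 <= gl w) ->
  (forall w, gl w <= 2 * gam n *
    (p x * - \int[mu x]_y ip (unitv (y - Z n w)) (Z n w - m)) / (1 + `|Z n w - m| ^+ 2)) ->
  \int[P]_w (\1_A w * lyap n.+1 w) <=
  \int[P]_w (\1_A w * (lyap n w + step_error beta C3 MK Mp rho (gam n) (h n) - gl w)).
Proof.
move=> sA mgl gl0 glle.
have mA : measurable A by exact: (sigma_past_measurable n).
have [C CP] := Zalg_bounded n.
have [B BP] := lyap_bounded n; have [B' BP'] := lyap_bounded n.+1.
pose next_lyap (z : H) w :=
  ln (1 + `|z + (gam n * (h n)^-1 * K ((X n.+1 w - x) / h n)) *:
    unitv ((Y n.+1 w : H) - z) - m| ^+ 2).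
pose C' := C + gam n * (MK / h n).
pose err := step_error beta C3 MK Mp rho (gam n) (h n).
pose ub w := lyap n w + err - gl w.
have next0 z w : 0 <= next_lyap z w by rewrite ln_ge0// lerDl sqr_ge0.
have nextC w w' : next_lyap (Z n w) w' <= C' ^+ 2.
  apply: lnD1_le => //.
  apply: (le_trans (norm_step_le n _ _ _ (coef_ge0 n _) (coef_le n _))).
  by rewrite /C' lerD2r.
have mnext z : measurable_fun setT (next_lyap z).
  apply: measurableT_comp => //; apply: measurable_funD => //; apply: measurable_funX.
  have mc (c : H) : measurable_fun setT ((fun=> c) : Omega -> borelType H).
    exact: measurable_cst.
  apply: measurable_normv; apply: (measurable_subv Hsep _ _ _ (mc m)).
  apply: (measurable_addv Hsep _ _ (mc z)); apply: (measurable_scalev Hsep).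
    apply: measurable_funM => //; apply: (measurableT_comp mK).
    by apply: measurable_funM => //; exact: measurable_funB.
  by apply: (measurable_unitv Hsep); apply: (measurable_subv Hsep _ _ (mY n.+1) (mc z)).
have inext w : P.-integrable setT (EFin \o next_lyap (Z n w)).
  by apply: (bounded_integrable P _ (C' ^+ 2)) => // w'; rewrite ger0_norm.
have Enext w : \int[P]_w' next_lyap (Z n w) w' <= ub w.
  have := one_step_drift Hip Hsep p0 _ _ A3 (Hlaw n.+1) mp _ _ _ _ pM mK K0 KM rho0 Krho K1
    beta0 C30 x _ _ (Z n w) m (gam0 n) (h0 n).
  move=> /le_trans; apply; rewrite /ub /err.
  by have := glle w; rewrite /lyap; lra.
(* Freezing: the first coordinate determines [A] and [Z n], the second the new observation. On the
   diagonal [F] is the true integrand. *)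
pose F (z : g_sigma_algebraType (past X Y n) * g_sigma_algebraType (newest X Y n)) : \bar R :=
  (\1_A (z.1 : Omega) * next_lyap (Z n z.1) z.2)%:E.
have F0 z : (0 <= F z)%E by rewrite lee_fin mulr_ge0.
have mF : measurable_fun setT F.
  apply/measurable_EFinP; apply: measurable_funM.
    have mi : measurable_fun setT
        (\1_(A : set (g_sigma_algebraType (past X Y n))) : _ -> R).
      exact: measurable_indic.
    by apply: (measurableT_comp mi); exact: measurable_fst.
  apply: measurableT_comp => //; apply: measurable_funD => //; apply: measurable_funX.
  have mZ1 : measurable_fun setT ((fun z => Z n z.1) :
      g_sigma_algebraType (past X Y n) * g_sigma_algebraType (newest X Y n) -> borelType H).
    apply: (measurableT_comp (measurable_Zalg X Y _ _ _ _ _ _ Hsep mK)).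
    exact: measurable_fst.
  have mX2 : measurable_fun setT ((fun z => X n.+1 z.2) :
      g_sigma_algebraType (past X Y n) * g_sigma_algebraType (newest X Y n) -> R).
    by apply: (measurableT_comp (measurable_newest_X X Y n)); exact: measurable_snd.
  have mY2 : measurable_fun setT ((fun z => Y n.+1 z.2) :
      g_sigma_algebraType (past X Y n) * g_sigma_algebraType (newest X Y n) -> borelType H).
    by apply: (measurableT_comp (measurable_newest_Y X Y n)); exact: measurable_snd.
  apply: measurable_normv; apply: (measurable_subv Hsep); last exact: measurable_cst.
  apply: (measurable_addv Hsep _ _ mZ1); apply: (measurable_scalev Hsep).
    apply: measurable_funM => //; apply: (measurableT_comp mK).
    by apply: measurable_funM => //; exact: measurable_funB.
  by apply: (measurable_unitv Hsep); exact: (measurable_subv Hsep).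
have fub := ge0_fubini_indep _ _ (past_measurable X Y mX mY n) (newest_measurable X Y mX mY n)
  (past_setI X Y n) (newest_setI X Y n) (past_setT X Y n) (newest_setT X Y n)
  (past_newest_indep X Y Hindep n) F F0 mF.
have indic01 w : 0 <= (\1_A w : R) <= 1 by rewrite indicE ler0n lern1 leq_b1.
have ub0 w : 0 <= ub w by apply: le_trans (Enext w); exact: Rintegral_ge0.
have mub : measurable_fun setT ub.
  by apply: measurable_funB => //; apply: measurable_funD => //; exact: measurable_lyap.
have ubB w : ub w <= B + err.
  by rewrite /ub; have := gl0 w; have := BP w; lra.
have iub : P.-integrable setT (EFin \o (fun w => \1_A w * ub w)).
  apply: (bounded_integrable P _ (B + err)).
    by apply: measurable_funM => //; exact: measurable_indic.
  move=> w; have /andP[i0 i1] := indic01 w.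
  rewrite ger0_norm ?mulr_ge0//; apply: le_trans (ubB w).
  by rewrite -[leRHS]mul1r ler_wpM2r.
have inx : P.-integrable setT (EFin \o (fun w => \1_A w * lyap n.+1 w)).
  apply: (bounded_integrable P _ B').
    by apply: measurable_funM; [exact: measurable_indic|exact: measurable_lyap].
  move=> w; have /andP[i0 i1] := indic01 w.
  rewrite ger0_norm ?mulr_ge0 ?lyap_ge0//; apply: le_trans (BP' w).
  by rewrite -[leRHS]mul1r ler_wpM2r// lyap_ge0.
apply: fine_le; [exact: integrable_fin_num..|].
rewrite -[leLHS]/(\int[P]_w F (w, w))%E fub.
have mul0 w : 0 <= \1_A w * ub w by have /andP[i0 _] := indic01 w; rewrite mulr_ge0.
apply: ge0_le_integral => //.
- by move=> w _; apply: integral_ge0.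
- by apply: measurable_fubini_indep => //; [exact: past_measurable|exact: newest_measurable].
- by apply/measurable_EFinP; apply: measurable_funM => //; exact: measurable_indic.
move=> w _.
have iA : P.-integrable setT (EFin \o (fun w' => \1_A w * next_lyap (Z n w) w')).
  by have := integrableZl measurableT (\1_A w) (inext w).
rewrite -[leLHS]fineK; last by rewrite integrable_fin_num.
rewrite lee_fin -[leLHS]/(\int[P]_w' (\1_A w * next_lyap (Z n w) w')).
rewrite (RintegralZl _ measurableT (inext w)).
by have /andP[i0 _] := indic01 w; rewrite ler_wpM2l.
Qed.

End conditional_step.

(** * Choice of constants and verification of the almost-supermartingale conditions *)

Theorem theorem2p1
  (R : realType)
  (* separable real Hilbert space H with inner product ip *)
  (H : completeNormedModType R) (ip : H -> H -> R)
  (Hip : is_inner_product ip) (Hsep : separable_space H)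
  (* probability space and the i.i.d. sample (X_{n+1}, Y_{n+1}) = (X n, Y n) *)
  (d : measure_display) (Omega : measurableType d) (P : probability Omega R)
  (X : nat -> Omega -> R) (Y : nat -> Omega -> borelType H)
  (* density p of X and conditional laws mu x of Y given X = x *)
  (p : R -> R) (mu : R -> probability (borelType H) R)
  (Hp0 : forall x, 0 <= p x)
  (Hlaw : forall n, joint_law P (X n) (Y n) p mu)
  (Hindep : indep_pairs P X Y)
  (* kernel, steps gam n = gamma_{n+1}, bandwidths h n = h_{n+1} *)
  (K : R -> R) (gam h : nat -> R)
  (Hgam : forall n, 0 < gam n) (Hh : forall n, 0 < h n)
  (beta C2 C3 : R) (Hbeta : 0 < beta) (HC2 : 0 < C2) (HC3 : 0 < C3)
  (* (A1) *)
  (A1 : forall x, closure [set x' | 0 < p x'] x ->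
          forall v : H, exists w : H, ip v w = 0 /\ (0 < cond_var mu x (ip w))%E)
  (* (A2) *)
  (A2bnd : exists M : R, forall x, p x <= M)
  (A2 : forall x x', `|p x - p x'| <= C2 * `|x - x'| `^ beta)
  (* (A3) *)
  (A3 : forall (x x' : R) (alpha phi phi' : H),
          is_Phi ip p mu x alpha phi -> is_Phi ip p mu x' alpha phi' ->
          `|phi - phi'| <= C3 * `|x - x'| `^ beta)
  (* (A5) *)
  (A5meas : measurable_fun setT K)
  (A5pos : forall u, 0 <= K u)
  (A5bnd : exists M : R, forall u, K u <= M)
  (A5supp : compact (closure [set u | K u != 0]))
  (A5int : (\int[lebesgue_measure]_u (K u)%:E = 1)%E)
  (* step-size conditions *)
  (Hs1 : (\sum_(n <oo) (gam n)%:E = +oo)%E)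
  (Hs2 : (\sum_(n <oo) (gam n ^+ 2 / h n)%:E < +oo)%E)
  (Hs3 : (\sum_(n <oo) (gam n * h n `^ beta)%:E < +oo)%E)
  (* initial point Z_1(x) = z1 *)
  (z1 : H) :
  forall x : R, 0 < p x ->
  forall m : H, (forall alpha : H, Gfun p mu m x <= Gfun p mu alpha x) ->
  {ae P, forall w : Omega,
     (fun n => `|Zalg K gam h X (fun k o => (Y k o : H)) x z1 n w - m|) @ \oo --> (0 : R)}.
Proof.
move=> x px m mmin.
have [Mp pM] := A2bnd; have [MK KM] := A5bnd.
have mp := holder_measurable _ _ _ HC2 Hbeta A2.
have MK0 : 0 <= MK by exact: le_trans (A5pos 0) (KM 0).
have Mp0 : 0 <= Mp by exact: le_trans (Hp0 0) (pM 0).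
have [rho rho0 Krho] : exists2 rho, 0 <= rho & forall u, K u != 0 -> `|u| <= rho.
  have [M [_ MP]] := compact_bounded A5supp.
  exists (`|M| + 1) => [|u Ku]; first by rewrite addr_ge0.
  by apply: (MP (`|M| + 1)) => /=; [have := ler_norm M; lra|exact: subset_closure].
pose Q := @lyap R H d Omega X Y K gam h x z1 m.
pose c n := step_error beta C3 MK Mp rho (gam n) (h n).
have v0 n : 0 <= gam n * h n `^ beta by rewrite mulr_ge0 ?powR_ge0// ltW.
have w0 n : 0 <= gam n ^+ 2 / h n by rewrite divr_ge0 ?sqr_ge0// ltW.
have cst0 : 0 <= C3 * rho `^ beta by rewrite mulr_ge0 ?powR_ge0// ltW.
have c0 n : 0 <= c n.
  by apply: addr_ge0; apply: mulr_ge0 => //; exact: mulr_ge0.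
have [S1 S1P] := nneseries_partial_bound _ v0 Hs3.
have [S2 S2P] := nneseries_partial_bound _ w0 Hs2.
pose S := C3 * rho `^ beta * S1 + MK * Mp * S2.
have sumc n : \sum_(i < n) c i <= S.
  rewrite big_split/= -!mulr_sumr.
  exact: lerD (ler_wpM2l cst0 (S1P n)) (ler_wpM2l (mulr_ge0 MK0 Mp0) (S2P n)).
pose nu := mu x.
(* Dividing by [p x > 0] turns a minimizer of [Gfun] into a geometric median of the conditional
   law. *)
have numin alpha : \int[nu]_y (`|y - m| - `|y|) <= \int[nu]_y (`|y - alpha| - `|y|).
  by have := mmin alpha; rewrite /Gfun ler_pM2l.
have xsupp : closure [set x' | 0 < p x'] x by exact: subset_closure.
have [a1 [a2 [a10 a12 a1s a2s]]] :=
  support_not_on_line Hip Hsep nu m (A1 x xsupp).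
have drift0 z := median_drift_ge0 Hip Hsep nu m numin z.
have [B BP] := choice (@lyap_bounded R H d Omega X Y K gam h MK Hgam Hh A5pos KM x z1 m).
(* The band for [Q] becomes an annulus: eps <= ln (1 + V) <= V gives |z - m| >= sqrt eps, and 1 + V
   < exp lam gives |z - m| <= exp lam, as |z - m| <= 1 + V. There the drift is at least [k], and the
   denominator is at most exp lam. *)
have driftQ eps lam : 0 < eps -> exists2 kap, 0 < kap & forall n w,
    eps <= Q n w < lam -> gam n * kap <= 2 * gam n *
      (p x * - \int[mu x]_y ip (unitv (y - Zalg K gam h X (fun k o => (Y k o : H)) x z1 n w))
        (Zalg K gam h X (fun k o => (Y k o : H)) x z1 n w - m)) /
        (1 + `|Zalg K gam h X (fun k o => (Y k o : H)) x z1 n w - m| ^+ 2).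
  move=> eps0.
  have [k k0 kP] := median_drift_gt0 Hip Hsep nu m numin a1 a2 a10 a12 a1s a2s
    (Num.sqrt eps) (expR lam) ltac:(by rewrite sqrtr_gt0).
  exists (2 * (p x * k) / expR lam).
    by rewrite divr_gt0 ?expR_gt0// !mulr_gt0.
  move=> n w /andP[]; rewrite /Q /lyap.
  set z := Zalg _ _ _ _ _ _ _ _ _; set V := `|z - m| ^+ 2 => epsQ Qlam.
  have V0 : 0 <= V by exact: sqr_ge0.
  have V1 : 0 < 1 + V by lra.
  have Vlam : 1 + V < expR lam by rewrite -[ltLHS]lnK ?posrE// ltr_expR.
  have epsV : eps <= V by apply: (le_trans epsQ); apply: le_ln1Dx; lra.
  have kz : k <= - \int[mu x]_y ip (unitv (y - z)) (z - m).
    apply: kP; apply/andP; split.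
      by rewrite -(@ler_pXn2r _ 2)// ?nnegrE ?sqrtr_ge0// sqr_sqrtr ?(ltW eps0).
    apply: le_trans (ltW Vlam); rewrite /V.
    by have := sqr_ge0 (`|z - m| - 1); rewrite sqrrB1 -mulr_natl; have := normr_ge0 (z - m); lra.
  have -> : gam n * (2 * (p x * k) / expR lam) = 2 * gam n * (p x * k) / expR lam.
    by ring.
  have g2 : 0 < 2 * gam n by rewrite mulr_gt0.
  apply: ler_pM.
  - by apply: mulr_ge0; apply: ltW => //; exact: mulr_gt0.
  - by rewrite invr_ge0 expR_ge0.
  - by rewrite ler_pM2l// ler_pM2l.
  - by rewrite lef_pV2 ?posrE ?expR_gt0// ltW.
have rate0 n z : 0 <= 2 * gam n *
    (p x * - \int[mu x]_y ip (unitv (y - z)) (z - m)) / (1 + `|z - m| ^+ 2).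
  apply: divr_ge0; last by rewrite addr_ge0// sqr_ge0.
  apply: mulr_ge0; first by rewrite mulr_ge0// ltW.
  by apply: mulr_ge0; [exact: ltW|exact: drift0].
(* The lower bound [gl] of the drift is used in two forms: zero, on arbitrary events of the past,
   for the supermartingale inequality; and [gam n * kap] on the band, over the whole space, for the
   strict decrease. *)
have stepQ n A gl := @lyap_step R H ip Hip Hsep d Omega P X Y p mu Hp0 mp Hlaw Hindep
  K gam h beta C3 MK Mp rho Hgam Hh A3 pM A5meas A5pos KM rho0 Krho A5int (ltW Hbeta)
  (ltW HC3) x z1 m n A gl.
have mQ n : measurable_fun setT (Q n).
  exact: (measurable_lyap Hsep Hlaw A5meas).
have Q0 n w : 0 <= Q n w by exact: lyap_ge0.
have iQ n A : measurable A -> P.-integrable setT (EFin \o (fun w => \1_A w * Q n w)).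
  move=> mA; apply: (bounded_integrable P _ (B n)).
    by apply: measurable_funM => //; exact: measurable_indic.
  move=> w; rewrite normrM (ger0_norm (Q0 n w)) ger0_norm//.
  apply: le_trans (BP n w).
  by rewrite -[leRHS]mul1r ler_wpM2r// indicE lern1 leq_b1.
pose F n := <<s past X Y n >>.
have Fm n : F n `<=` measurable by exact: sigma_past_measurable.
have : {ae P, forall w, Q n w @[n --> \oo] --> (0 : R)}.
  apply: (@almost_supermartingale_cvg0 R d Omega P Q F c gam B _ _ _ _ _ Q0 mQ Fm BP _ S).
  - by move=> n A A'; exact: (@measurableI _ (g_sigma_algebraType (past X Y n))).
  - by move=> n A A'; exact: (@measurableU _ (g_sigma_algebraType (past X Y n))).
  - by move=> n A; exact: (@measurableC _ (g_sigma_algebraType (past X Y n))).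
  - by move=> n; exact: sigma_past_sub.
  - move=> n a.
    have := measurable_past_lyap Hsep A5meas x z1 m n (X := X) (Y := Y) (gam := gam) (h := h).
    move=> /(_ measurableT `]-oo, a[%classic (measurable_itv _)); rewrite setTI.
    by congr (<<s _ >> _); apply/seteqP; split => w; rewrite /= in_itv.
  - move=> n A sA; have mA := Fm n A sA.
    have st : \int[P]_w (\1_A w * Q n.+1 w) <=
        \int[P]_w (\1_A w * (Q n w + c n - cst 0 w)).
      by apply: stepQ => // w; exact: rate0.
    apply: (le_trans st).
    have ic : P.-integrable setT (EFin \o (fun w => \1_A w * c n)).
      apply: (bounded_integrable P _ (c n)).
        by apply: measurable_funM => //; exact: measurable_indic.
      move=> w; rewrite normrM (ger0_norm (c0 n)) ger0_norm//.
      by rewrite -[leRHS]mul1r ler_wpM2r// indicE lern1 leq_b1.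
    have -> : \int[P]_w (\1_A w * (Q n w + c n - cst 0 w)) =
        \int[P]_w (\1_A w * Q n w + \1_A w * c n).
      by apply: eq_Rintegral => w _; rewrite subr0 mulrDr.
    rewrite (RintegralD measurableT (iQ n A mA) ic) lerD2l.
    rewrite -[leRHS](Rintegral_probability_cst P); apply: le_Rintegral => //.
      by apply: (bounded_integrable P (cst (c n)) (c n)) => // w; rewrite /= (ger0_norm (c0 n)).
    by move=> w _; rewrite -[leRHS]mul1r ler_wpM2r// indicE lern1 leq_b1.
  - by move=> n; exact: ltW.
  - move=> eps lam eps0; have [kap kap0 kapP] := driftQ eps lam eps0.
    exists kap => // n; set E := [set w | _].
    have mE : measurable E.
      rewrite /E (_ : [set w | _] = Q n @^-1` `[eps, lam[%classic).
        by rewrite -[Z in measurable Z]setTI; exact: mQ.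
      by apply/seteqP; split => w; rewrite /= in_itv.
    have gk0 : 0 <= gam n * kap by rewrite mulr_ge0// ltW.
    have iE : P.-integrable setT (EFin \o (fun w => \1_E w * (gam n * kap))).
      apply: (bounded_integrable P _ (gam n * kap)).
        by apply: measurable_funM => //; exact: measurable_indic.
      move=> w; rewrite normrM (ger0_norm gk0) ger0_norm//.
      by rewrite -[leRHS]mul1r ler_wpM2r// indicE lern1 leq_b1.
    have iQn : P.-integrable setT (EFin \o Q n).
      by apply: (bounded_integrable P _ (B n)) => // w; rewrite ger0_norm// BP.
    have icn : P.-integrable setT (EFin \o (fun _ : Omega => c n)).
      by apply: (bounded_integrable P (cst (c n)) (c n)) => // w; rewrite /= (ger0_norm (c0 n)).
    have iQc : P.-integrable setT (EFin \o (fun w => Q n w + c n)).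
      by have := integrableD measurableT iQn icn.
    have st : \int[P]_w (\1_setT w * Q n.+1 w) <=
        \int[P]_w (\1_setT w * (Q n w + c n - \1_E w * (gam n * kap))).
      apply: stepQ.
      - exact: (@measurableT _ (g_sigma_algebraType (past X Y n))).
      - by apply: measurable_funM => //; exact: measurable_indic.
      - by move=> w; rewrite mulr_ge0.
      - move=> w; rewrite indicE; case: (boolP (w \in E)) => [/set_mem Ew|_].
          by rewrite mul1r; exact: kapP.
        by rewrite mul0r; exact: rate0.
    have -> : \int[P]_w Q n.+1 w = \int[P]_w (\1_setT w * Q n.+1 w).
      by apply: eq_Rintegral => w _; rewrite indicT mul1r.
    apply: (le_trans st).
    have -> : \int[P]_w (\1_setT w * (Q n w + c n - \1_E w * (gam n * kap))) =
        \int[P]_w (Q n w + c n - \1_E w * (gam n * kap)).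
      by apply: eq_Rintegral => w _; rewrite indicT mul1r.
    rewrite (RintegralB measurableT iQc iE) (RintegralD measurableT iQn icn).
    rewrite Rintegral_probability_cst RintegralZr//; last exact: integrable_indic.
    by rewrite /Rintegral integral_indic// setIT mulrC.
  - exact: sumc.
  - exact: partial_bound_tail c0 sumc.
  - by apply: nneseries_pinfty_partial => // n; exact: ltW.
apply: filterS => w /cvgrPdist_lt Qcv; apply/cvgrPdist_lt => e e0.
have e20 : 0 < e ^+ 2 by rewrite exprn_gt0.
(* The threshold for [Q] matching distance [e]: ln (1 + V^2) < ln (1 + e^2) forces V < e. *)
have le0 : 0 < ln (1 + e ^+ 2) by rewrite ln_gt0// ltrDl.
apply: filterS (Qcv _ le0) => n; rewrite !sub0r !normrN ger0_norm// normr_id.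
rewrite /Q /lyap; set V := `|_ - m|; have V2 := sqr_ge0 V.
have p1 : 1 + V ^+ 2 \is Num.pos by rewrite posrE; lra.
have p2 : 1 + e ^+ 2 \is Num.pos by rewrite posrE; lra.
by rewrite (ltr_ln p1 p2) ltrD2l ltr_pXn2r ?nnegrE ?normr_ge0 ?(ltW e0).
Qed.
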